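(* Let $\psi(x)=\sum_{n\le x}\Lambda(n)$, where $\Lambda$ is the von Mangoldt function. Fix $\epsilon>0$ and suppose there are absolute constants $A,B>1$ such that for every even positive integer $k$, $$\int_{1}^{X} (\psi(x+h) - \psi(x) - h)^k\, dx = \frac{\Gamma(k+1)}{\Gamma(\frac{k}{2}+1) 2^{k/2}} X h^{k/2} \Bigl(\log{\frac{X}{h}}\Bigr)^{k/2} + O\bigl(A^{B^k} X h^{k/2} (\log X)^{k/2 - 1}\bigr)$$ uniformly for $X^\epsilon \leq h \leq X^{1-\epsilon}$ (the implied constant being independent of $k$, $X$, $h$). Then for any $\lambda > 0$, $$\int_{1}^{X} |\psi(x+h) - \psi(x) -h|^{\lambda}\, dx = \frac{\Gamma(\lambda+1)}{\Gamma(\frac{\lambda}{2}+1) 2^{\lambda/2}} X h^{\lambda/2} \Bigl(\log\frac{X}{h}\Bigr)^{\lambda/2} + O_{\lambda} \Bigl(\frac{X h^{\lambda/2} (\log\frac{X}{h})^{\lambda/2}}{\log_{4}{X}} \Bigr)$$ uniformly for $X^{\epsilon} \leq h \leq X^{1-\epsilon}$ (as $X\to\infty$).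
   Context: $\Gamma$ is the gamma function. $\log_n x$ denotes the $n$-times iterated logarithm: $\log_1 x=\log x$, $\log_{i+1}x=\log(\log_i x)$. The implied constant in $O_\lambda$ may depend on $\lambda$ (and on the fixed $\epsilon, A, B$). *)

(* Defs.v *)
From mathcomp Require Import all_boot all_order all_algebra.
From mathcomp Require Import all_classical all_reals all_analysis.
Set Implicit Arguments.
Unset Strict Implicit.
Unset Printing Implicit Defensive.
Import Order.TTheory GRing.Theory Num.Theory.
Local Open Scope classical_set_scope.
Local Open Scope ring_scope.

(* [primes n] is the list of the distinct prime divisors of [n] (empty for
   [n <= 1]), so it is [:: p] exactly when n = p ^ m for some m >= 1; see
   [mangoldt_pfactor] and [mangoldt_eq0]. *)
Definition mangoldt (R : realType) (n : nat) : R :=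
  if primes n is [:: p] then ln (p%:R : R) else 0.

(* [Num.truncn x] is the integer part of [x] for [0 <= x], and 0 otherwise. *)
Definition chebyshev_psi (R : realType) (x : R) : R :=
  \sum_(1 <= n < (Num.truncn x).+1) mangoldt R n.

(* The integral converges for [0 < x], the only range where it is meant. *)
Definition Gamma (R : realType) (x : R) : R :=
  \int[lebesgue_measure]_(t in `]0, +oo[) (t `^ (x - 1) * expR (- t)).

Lemma mangoldt_pfactor (R : realType) (p m : nat) :
  prime p -> (0 < m)%N -> mangoldt R (p ^ m) = ln p%:R.
Proof. by move=> pp m0; rewrite /mangoldt primesX// primes_prime. Qed.

Lemma mangoldt_eq0 (R : realType) (n : nat) :
  (forall p m, prime p -> (0 < m)%N -> n <> (p ^ m)%N) -> mangoldt R n = 0.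
Proof.
move=> nP; rewrite /mangoldt.
case En: (primes n) => [//|p [|//]].
have : p \in primes n by rewrite En mem_head.
rewrite mem_primes => /and3P[pp n0 pn]; exfalso.
have [||] // := nP p (logn p n); first by rewrite logn_gt0 En mem_head.
rewrite {1}(prod_prime_decomp n0) prime_decompE En /=.
by rewrite big_cons big_nil muln1.
Qed.

(* Main.v *)
(* Write [g = |psi(x + h) - psi(x) - h| / sqrt (h ln (X / h))] and let [R_J] and
   [G_J] be the signed Taylor remainders of order [J] of [cos] and of
   [w |-> exp (- w)]; both are nonnegative on the half-line.  For
   [2 J - 2 < lambda < 2 J], scaling gives
     [k1 * y `^ lambda = \int_0^oo R_J(u y) u `^ (- lambda - 1) du],
   so the [lambda]-th moment of [g] is a Mellin transform of the average of
   [R_J(u g)].  The Taylor coefficients of that average are the even moments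
   of [g]; since the first [N] of them are nearly Gaussian, it is close to
   [G_J(u ^ 2 / 2)] for [u] up to about [sqrt N], and beyond that the trivial
   bound [u ^ (2 J - 2)] is integrable against the weight.  The hypothesis
   controls all moments up to a power [N] of [ln ln ln X], which yields an error
   of a power of [1 / N], hence [O(1 / ln ln ln ln X)].  The limit constant is [k2 / k1] with
   [k2] the Mellin transform of [G_J(u ^ 2 / 2)]; it equals the quotient of Gamma
   values because the Laplace transforms of [t |-> R_J(u t)] and of
   [t |-> G_J(u ^ 2 t)] are both [u ^ (2 J) / (1 + u ^ 2)], so that integrating
   the two scaling identities against [exp (- t)] yields the same number.
   Even integers [lambda] are read off the hypothesis directly. *)
Require Import Defs.
From mathcomp Require Import all_boot all_order all_algebra.
From mathcomp Require Import all_classical all_reals all_analysis.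
From mathcomp Require Import measurable_realfun ring lra.
Set Implicit Arguments.
Unset Strict Implicit.
Unset Printing Implicit Defensive.
Import Order.TTheory GRing.Theory Num.Theory.
Import numFieldNormedType.Exports.
Local Open Scope classical_set_scope.
Local Open Scope ring_scope.

(** * Alternating Taylor remainders of cos and exp *)

Section remainders.
Context {R : realType}.
Implicit Types (x y u v w t : R) (j J N : nat).

(* [(-1) ^ J] times the error of the [J]-term partial sum of the alternating
   series [\sum_j (-1) ^ j a_j] with sum [x]. *)
Fixpoint alt_rem (a : nat -> R) (x : R) J : R :=
  if J is j.+1 then a j - alt_rem a x j else x.

(** With the sign absorbed, differentiation is sign-free: [cos_rem J.+1] has derivative [sin_rem J],
    which has derivative [cos_rem J], and [exp_rem J.+1] has derivative [exp_rem J]. *)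
Definition cos_rem J v := alt_rem (fun j => v ^+ j.*2 / j.*2`!%:R) (cos v) J.
Definition sin_rem J v :=
  alt_rem (fun j => v ^+ j.*2.+1 / j.*2.+1`!%:R) (sin v) J.
Definition exp_rem J w := alt_rem (fun j => w ^+ j / j`!%:R) (expR (- w)) J.

Lemma cos_remS J v :
  cos_rem J.+1 v = v ^+ J.*2 / J.*2`!%:R - cos_rem J v.
Proof. by []. Qed.

Lemma sin_remS J v :
  sin_rem J.+1 v = v ^+ J.*2.+1 / J.*2.+1`!%:R - sin_rem J v.
Proof. by []. Qed.

Lemma exp_remS J w : exp_rem J.+1 w = w ^+ J / J`!%:R - exp_rem J w.
Proof. by []. Qed.

Lemma is_derive_monomial j x :
  is_derive x 1 (fun y => y ^+ j.+1 / j.+1`!%:R) (x ^+ j / j`!%:R).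
Proof.
have -> : (fun y => y ^+ j.+1 / j.+1`!%:R) = (j.+1`!%:R^-1 : R) \*: (id ^+ j.+1).
  by apply/funext => y /=; rewrite mulrC; congr (_ * _); rewrite exprfctE.
apply: is_derive_eq; rewrite -[LHS]/(_ * (_ * _)) mulr1 factS natrM.
have h1 : (j.+1)%:R != 0 :> R by rewrite pnatr_eq0.
have h2 : (j`!)%:R != 0 :> R by rewrite pnatr_eq0 -lt0n fact_gt0.
rewrite /= -mulr_natl; field.
by rewrite h2 nat1r h1.
Qed.

Lemma is_derive_cos_remS J v : is_derive v 1 (cos_rem J.+1) (sin_rem J v).
Proof.
elim: J v => [|J IH] v.
  have -> : cos_rem 1 = cst (1 : R) - cos.
    by apply/funext => y; rewrite /cos_rem /= expr0 fact0 divr1.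
  have := is_deriveB (is_derive_cst (1 : R) v 1) (is_derive_cos v).
  by rewrite sub0r opprK; exact.
have -> : cos_rem J.+2 = (fun y => y ^+ J.*2.+2 / J.*2.+2`!%:R) - cos_rem J.+1.
  by apply/funext.
by have := is_deriveB (is_derive_monomial _ _) (IH _); exact.
Qed.

Lemma is_derive_sin_rem J v : is_derive v 1 (sin_rem J) (cos_rem J v).
Proof.
elim: J v => [|J IH] v; first exact: is_derive_sin.
have -> : sin_rem J.+1 = (fun y => y ^+ J.*2.+1 / J.*2.+1`!%:R) - sin_rem J.
  by apply/funext.
by have := is_deriveB (is_derive_monomial _ _) (IH _); exact.
Qed.

Lemma is_derive_exp_remS J w : is_derive w 1 (exp_rem J.+1) (exp_rem J w).
Proof.
elim: J w => [|J IH] w.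
  have -> : exp_rem 1 = cst (1 : R) - (expR \o -%R).
    by apply/funext => y; rewrite /exp_rem /= expr0 fact0 divr1.
  have h : is_derive w 1 (expR \o -%R) (expR (- w) * -1).
    exact: is_derive1_comp.
  have := is_deriveB (is_derive_cst (1 : R) w 1) h.
  by rewrite sub0r mulrN1 opprK; exact.
have -> : exp_rem J.+2 = (fun y => y ^+ J.+1 / J.+1`!%:R) - exp_rem J.+1.
  by apply/funext.
by have := is_deriveB (is_derive_monomial _ _) (IH _); exact.
Qed.

(** At the origin both series reduce to their constant term 1, so nothing remains once it has been
    subtracted. *)
Lemma alt_rem_zero (a : nat -> R) J : (forall j, (0 < j)%N -> a j = 0) -> a 0 = 1 ->
  alt_rem a 1 J.+1 = 0.
Proof.
move=> a0 a1; elim: J => [|J IH]; first by rewrite /= a1 subrr.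
by rewrite -[LHS]/(a J.+1 - alt_rem a 1 J.+1) IH a0// subrr.
Qed.

Lemma cos_rem0 J : cos_rem J.+1 0 = 0.
Proof.
rewrite /cos_rem cos0; apply: alt_rem_zero => [[//|j] _|].
  by rewrite expr0n /= mul0r.
by rewrite expr0 fact0 divr1.
Qed.

Lemma exp_rem0 J : exp_rem J.+1 0 = 0.
Proof.
rewrite /exp_rem oppr0 expR0; apply: alt_rem_zero => [[//|j] _|].
  by rewrite expr0n /= mul0r.
by rewrite expr0 fact0 divr1.
Qed.

Lemma sin_rem0 J : sin_rem J 0 = 0.
Proof.
elim: J => [|J IH]; first exact: sin0.
by rewrite sin_remS IH expr0n /= mul0r subrr.
Qed.

Lemma ge0_derive_ge0 (f F : R -> R) :
  (forall x, is_derive x 1 F (f x)) -> F 0 = 0 ->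
  (forall x, 0 <= x -> 0 <= f x) -> forall x, 0 <= x -> 0 <= F x.
Proof.
move=> dF F0 f0 x; rewrite le_eqVlt => /predU1P[<-|x0]; first by rewrite F0.
have [|c] := @MVT R F f 0 x x0 (fun y _ => dF y).
  apply: continuous_subspaceT => y.
  by apply: differentiable_continuous; apply/derivable1_diffP; case: (dF y).
rewrite in_itv /= => /andP[c0 _]; rewrite F0 !subr0 => ->.
by rewrite mulr_ge0 ?f0// ltW.
Qed.

(** Each step integrates twice from 0, starting from 1 - cos v >= 0; order 0 is excluded because cos
    itself changes sign. *)
Lemma cos_rem_ge0 J v : (0 < J)%N -> 0 <= v -> 0 <= cos_rem J v.
Proof.
case: J => // J _; elim: J v => [|J IH] v v0.
  by rewrite /cos_rem /= expr0 fact0 divr1 subr_ge0 cos_le1.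
move: v v0; apply: (ge0_derive_ge0 (is_derive_cos_remS J.+1)).
  exact: cos_rem0.
apply: (ge0_derive_ge0 (is_derive_sin_rem J.+1)); first exact: sin_rem0.
exact: IH.
Qed.

Lemma exp_rem_ge0 J w : 0 <= w -> 0 <= exp_rem J w.
Proof.
elim: J w => [|J IH] w w0; first exact: expR_ge0.
move: w w0; apply: (ge0_derive_ge0 (is_derive_exp_remS J)) => //.
exact: exp_rem0.
Qed.

Lemma continuous_cos_rem J : continuous (cos_rem J).
Proof.
case: J => [|J]; first exact: continuous_cos.
move=> v; apply: differentiable_continuous; apply/derivable1_diffP.
by case: (is_derive_cos_remS J v).
Qed.

Lemma continuous_exp_rem J : continuous (exp_rem J).
Proof.
case: J => [|J] v; last first.
  apply: differentiable_continuous; apply/derivable1_diffP.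
  by case: (is_derive_exp_remS J v).
by apply: continuous_comp; [exact: continuousN|exact: continuous_expR].
Qed.

(** The preceding remainder is nonnegative, so this one is at most its leading term; the factor 2
    covers J = 0, where 1 - cos v can reach 2. *)
Lemma cos_rem_le J v : 0 <= v -> cos_rem J.+1 v <= 2 * v ^+ J.*2.
Proof.
move=> v0; case: J => [|J].
  rewrite /cos_rem /= expr0 fact0 divr1 mulr1 lerBlDr.
  by have := cos_geN1 v; lra.
rewrite cos_remS; have := @cos_rem_ge0 J.+1 v isT v0.
have h : v ^+ (J.+1).*2 / ((J.+1).*2)`!%:R <= v ^+ (J.+1).*2.
  rewrite ler_pdivrMr ?ltr0n ?fact_gt0// ler_peMr ?exprn_ge0//.
  by rewrite ler1n fact_gt0.
have : 0 <= v ^+ (J.+1).*2 by rewrite exprn_ge0.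
by move: h; lra.
Qed.

Lemma exp_rem_le J w : 0 <= w -> exp_rem J.+1 w <= w ^+ J.
Proof.
move=> w0; rewrite exp_remS; have := @exp_rem_ge0 J w w0.
have h : w ^+ J / J`!%:R <= w ^+ J.
  rewrite ler_pdivrMr ?ltr0n ?fact_gt0// ler_peMr ?exprn_ge0//.
  by rewrite ler1n fact_gt0.
by move: h; lra.
Qed.

(* Unfolding the recursion up to [N] turns termwise closeness of the two series
   into closeness of the remainders, with no loss from the sign alternation. *)
Lemma alternating_closeness (p q a b : nat -> R) J N : (J <= N)%N ->
  (forall j, (J <= j)%N -> 0 <= a j /\ 0 <= b j) ->
  (forall j, (J <= j <= N)%N -> a j + a j.+1 = p j /\ b j + b j.+1 = q j) ->
  `|a J - b J| <= \sum_(J <= j < N.+1) `|p j - q j| + q N.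
Proof.
move=> JN; rewrite -(subnKC JN); move: (N - J)%N => n {N JN}.
elim: n J => [|n IH] J ge0 eqs.
  (* Nonnegativity puts [a J] in [0, p J] and [b J] in [0, q J], so the difference lies between - q
     J and p J. *)
  rewrite addn0 big_nat1.
  have [|e1 e2] := eqs J; first by rewrite addn0 leqnn.
  have [a0 b0] := ge0 J (leqnn _); have [a1 b1] := ge0 J.+1 (leqnSn _).
  have : p J - q J <= `|p J - q J| by exact: ler_norm.
  have : 0 <= `|p J - q J| by exact: normr_ge0.
  by rewrite ler_norml => n0 n1; apply/andP; split; lra.
rewrite big_ltn; last by rewrite ltnS leq_addr.
have [|e1 e2] := eqs J; first by rewrite leqnn leq_addr.
have := IH J.+1; rewrite addSn -addnS => IH'.
have {}IH' : `|a J.+1 - b J.+1| <= \sum_(J.+1 <= j < (J + n.+1).+1) `|p j - q j|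
     + q (J + n.+1)%N.
  apply: IH' => [j|j /andP[h1 h2]]; first by move/ltnW; exact: ge0.
  by apply: eqs; rewrite (ltnW h1).
have -> : a J - b J = (p J - q J) - (a J.+1 - b J.+1) by rewrite -e1 -e2; ring.
by rewrite (le_trans (ler_normB _ _))// -addrA lerD2l.
Qed.

End remainders.

(** * Exponential integrals and Laplace transforms *)

Section exponential_integrals.
Context {R : realType}.
Implicit Types (f F K G : R -> R) (x u v w t c : R) (n J : nat).
Local Notation mu := (@lebesgue_measure R).

Lemma is_derive_continuous f F : (forall x, is_derive x 1 F (f x)) ->
  continuous F.
Proof.
move=> dF x; apply: differentiable_continuous; apply/derivable1_diffP.
by case: (dF x).
Qed.

Lemma ge0_integral_primitive f F (a l : R) : (forall x, a <= x -> 0 <= f x) ->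
  continuous f -> (forall x, is_derive x 1 F (f x)) -> F x @[x --> +oo] --> l ->
  (\int[mu]_(x in `[a, +oo[) (f x)%:E = (l - F a)%:E)%E.
Proof.
move=> f0 cf dF Fl; rewrite EFinB.
apply: ge0_continuous_FTC2y => //.
- exact: continuous_subspaceT.
- by apply: cvg_at_right_filter; exact: is_derive_continuous dF a.
- by move=> x _; rewrite derive1E; case: (dF x).
Qed.

(** The term of order n + 1 of the exponential series bounds the product by (n + 1)! / t. *)
Lemma cvgy_expRMX n : (expR (- t) * t ^+ n) @[t --> +oo] --> (0 : R).
Proof.
have lim : n.+1`!%:R * t^-1 @[t --> +oo] --> (0 : R).
  rewrite -[X in _ --> X](mulr0 (n.+1`!%:R)); apply: cvgMl_tmp.
  apply/(@gtr0_cvgV0 R _ (pinfty_nbhs R) _ id) => //.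
  by near=> t; near: t; apply: nbhs_pinfty_gt; rewrite num_real.
apply: (squeeze_cvgr _ (cvg_cst 0) lim); near=> t.
have t0 : 0 < t by near: t; apply: nbhs_pinfty_gt; rewrite num_real.
rewrite /cst /=; apply/andP; split.
  by rewrite mulr_ge0 ?expR_ge0 ?exprn_ge0 ?ltW.
rewrite expRN.
rewrite ler_pdivlMr//.
rewrite -mulrA -exprSr ler_pdivrMl ?expR_gt0// -ler_pdivrMr ?ltr0n ?fact_gt0//.
by rewrite (le_trans _ (expR_ge1Dxn n (ltW t0)))// lerDr.
Unshelve. all: by end_near. Qed.

Lemma is_derive_expRN t : is_derive t 1 (fun s => expR (- s)) (- expR (- t)).
Proof.
have h : is_derive t 1 (expR \o -%R) (expR (- t) * -1) by exact: is_derive1_comp.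
by rewrite mulrN1 in h.
Qed.

Lemma integral_fact_expRN n :
  (\int[mu]_(t in `[0%R, +oo[) (t ^+ n / n`!%:R * expR (- t))%:E = 1)%E.
Proof.
(* F is - exp (- t) times the sum of t^j / j! over j <= n, built by induction on n. *)
suff [F [dF Fy F0]] : exists F, [/\
    forall t, is_derive t 1 F (t ^+ n / n`!%:R * expR (- t)),
    F t @[t --> +oo] --> (0 : R) & F 0 = -1].
  have df t : is_derive t 1 (fun s : R => s ^+ n * (n`!%:R^-1 * expR (- s)))
     ('D_1 (fun s : R => s ^+ n * (n`!%:R^-1 * expR (- s))) t).
    split => //; apply: derivableM; first exact: exprn_derivable.
    by apply: derivableZ; case: (is_derive_expRN t).
  rewrite (@ge0_integral_primitive _ F 0 0) ?F0 ?sub0r ?opprK//.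
  - move=> t t0; rewrite mulr_ge0 ?expR_ge0// divr_ge0 ?exprn_ge0//.
  - have := is_derive_continuous df.
    by under eq_fun do rewrite mulrA.
elim: n => [|n [F [dF Fy F0]]].
  exists (fun t => - expR (- t)); split.
  - move=> t; rewrite expr0 fact0 divr1 mul1r.
    by have := is_deriveN (is_derive_expRN t); rewrite opprK; exact.
  - by rewrite -oppr0; apply: cvgN; exact: cvgr_expR.
  - by rewrite oppr0 expR0.
exists (F - (fun t => t ^+ n.+1 / n.+1`!%:R) * (fun t => expR (- t))); split.
- move=> t.
  have := is_deriveB (dF t) (is_deriveM (is_derive_monomial n t) (is_derive_expRN t)).
  move=> /is_derive_eq; apply; rewrite -![_ *: _]/(_ * _); ring.
- rewrite -(subr0 0); apply: cvgB => //.
  rewrite (_ : _ * _ = (fun t => n.+1`!%:R^-1 * (expR (- t) * t ^+ n.+1))).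
    by rewrite -(mulr0 (n.+1`!%:R^-1)); apply: cvgMl_tmp; exact: cvgy_expRMX.
  by apply/funext => t /=; rewrite fctE; ring.
- by rewrite !fctE F0 expr0n /= !mul0r subr0.
Qed.

End exponential_integrals.

(** * Laplace transforms of the remainders *)

Section laplace.
Context {R : realType}.
Implicit Types (f g K : R -> R) (x u v w t c : R) (n J : nat).
Local Notation mu := (@lebesgue_measure R).

Lemma continuous_measurable_itv (a : itv_bound R) (b : itv_bound R) f :
  continuous f -> measurable_fun [set` Interval a b] (fun t => (f t)%:E).
Proof.
move=> cf; apply/measurable_EFinP; apply: measurable_funTS.
exact: continuous_measurable_fun.
Qed.

Lemma continuous_mul f g : continuous f -> continuous g ->
  continuous (fun t => f t * g t).
Proof. by move=> cf cg t; apply: cvgM; [exact: cf|exact: cg]. Qed.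

Lemma continuous_compose f g : continuous f -> continuous g ->
  continuous (fun t => f (g t)).
Proof. by move=> cf cg t; apply: continuous_comp; [exact: cg|exact: cf]. Qed.

Lemma continuous_expRN : continuous (fun t : R => expR (- t)).
Proof. exact: is_derive_continuous is_derive_expRN. Qed.

(** The sum of f and g is c times a density of total mass 1. This is the induction step for the
    Laplace transforms: consecutive remainders are nonnegative and add up to a monomial. *)
Lemma integral_expRN_complement n c a f g :
  (forall t, 0 <= t -> 0 <= f t) -> (forall t, 0 <= t -> 0 <= g t) ->
  continuous f -> continuous g -> 0 <= c ->
  (forall t, f t + g t = c * (t ^+ n / n`!%:R * expR (- t))) ->
  (\int[mu]_(t in `[0%R, +oo[) (f t)%:E = a%:E)%E ->
  (\int[mu]_(t in `[0%R, +oo[) (g t)%:E = (c - a)%:E)%E.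
Proof.
move=> f0 g0 cf cg c0 fg fa.
have pos (h : R -> R) : (forall t : R, 0 <= t -> 0 <= h t) ->
    forall t, `[0%R, +oo[%classic t -> (0 <= (h t)%:E)%E.
  by move=> h0 t /=; rewrite in_itv/= andbT lee_fin; exact: h0.
have /= := @ge0_integralD _ _ R mu `[0%R, +oo[%classic (measurable_itv _)
  (fun t => (f t)%:E) (fun t => (g t)%:E) (pos _ f0)
  (continuous_measurable_itv cf) (pos _ g0)
  (continuous_measurable_itv cg).
under eq_integral do rewrite -EFinD fg EFinM.
rewrite ge0_integralZl//; first last.
- move=> t /=; rewrite in_itv/= andbT => t0.
  by rewrite lee_fin mulr_ge0 ?expR_ge0// divr_ge0 ?exprn_ge0.
- apply/measurable_EFinP/measurable_funTS.
  apply: measurable_funM; first exact: measurable_funM.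
  by apply: measurableT_comp => //; exact: measurable_expR.
rewrite integral_fact_expRN fa mule1 => h.
by rewrite EFinB h addeAC subee// add0e.
Qed.

(** Order 0 is the integral of exp (- (1 + u^2) t); the step is u^(2J) - u^(2J) / (1 + u^2) =
    u^(2J+2) / (1 + u^2). *)
Lemma laplace_exp_rem J u :
  (\int[mu]_(t in `[0%R, +oo[) (expR (- t) * exp_rem J (u ^+ 2 * t))%:E =
   (u ^+ J.*2 / (1 + u ^+ 2))%:E)%E.
Proof.
have u1 : 1 + u ^+ 2 != 0 by rewrite gt_eqF// ltr_wpDr ?sqr_ge0.
have cont j : continuous (fun t => expR (- t) * exp_rem j (u ^+ 2 * t)).
  apply: continuous_mul; first exact: continuous_expRN.
  apply: (@continuous_compose (exp_rem j) ( *%R (u ^+ 2))); first exact: continuous_exp_rem.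
 
  exact: mulrl_continuous.
have ge0 j t : 0 <= t -> 0 <= expR (- t) * exp_rem j (u ^+ 2 * t).
  by move=> t0; rewrite mulr_ge0 ?expR_ge0 ?exp_rem_ge0 ?(mulr_ge0 (sqr_ge0 u)).
elim: J => [|J IH].
  pose F t := - ((1 + u ^+ 2)^-1 * expR (- ((1 + u ^+ 2) * t))).
  have dF t : is_derive t 1 F (expR (- t) * exp_rem 0 (u ^+ 2 * t)).
    have h1 : is_derive t 1 (fun t : R => (1 + u ^+ 2) * t) (1 + u ^+ 2).
      have := is_deriveZ (1 + u ^+ 2) (is_derive_id t 1).
      by move=> /is_derive_eq; apply; rewrite -[_ *: _]/(_ * _) mulr1.
    have := is_deriveN (is_deriveZ (1 + u ^+ 2)^-1
      (is_derive1_comp (is_derive_expRN _) h1)).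
    move=> /is_derive_eq; apply; rewrite -![_ *: _]/(_ * _) /exp_rem/=.
    rewrite -expRD (_ : - t - _ = - ((1 + u ^+ 2) * t)); last by ring.
    by field.
  rewrite (@ge0_integral_primitive _ _ F 0 0)//.
  - by rewrite /F mulr0 oppr0 expR0 mulr1 sub0r opprK expr0 mul1r.
  - by move=> t; exact: ge0.
  - rewrite /F -oppr0; apply: cvgN.
    rewrite -(mulr0 (1 + u ^+ 2)^-1); apply: cvgMl_tmp.
    apply: (@cvg_comp _ _ _ (fun t => (1 + u ^+ 2) * t) (fun t => expR (- t)) _
      (pinfty_nbhs R)); last exact: cvgr_expR.
    by apply: gt0_cvgMry => //; rewrite ltr_wpDr ?sqr_ge0.
rewrite (@integral_expRN_complement J (u ^+ J.*2) (u ^+ J.*2 / (1 + u ^+ 2))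
  (fun t => expR (- t) * exp_rem J (u ^+ 2 * t)))//.
- by congr EFin; rewrite doubleS !exprS; field.
- by move=> t; exact: ge0.
- by move=> t; exact: ge0.
- by rewrite -mul2n exprM exprn_ge0 ?sqr_ge0.
- by move=> t; rewrite exp_remS exprMn -exprM mul2n; ring.
Qed.

(** Same recursion as for [exp_rem], started at order 1, the first nonnegative remainder. *)
Lemma laplace_cos_rem J u : 0 <= u ->
  (\int[mu]_(t in `[0%R, +oo[) (expR (- t) * cos_rem J.+1 (u * t))%:E =
   (u ^+ J.+1.*2 / (1 + u ^+ 2))%:E)%E.
Proof.
move=> u0; have u1 : 1 + u ^+ 2 != 0 by rewrite gt_eqF// ltr_wpDr ?sqr_ge0.
have cont j : continuous (fun t => expR (- t) * cos_rem j (u * t)).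
  apply: continuous_mul; first exact: continuous_expRN.
  apply: (@continuous_compose (cos_rem j) ( *%R u)); first exact: continuous_cos_rem.
  exact: mulrl_continuous.
have ge0 j t : 0 <= t -> 0 <= expR (- t) * cos_rem j.+1 (u * t).
  by move=> t0; rewrite mulr_ge0 ?expR_ge0 ?cos_rem_ge0 ?mulr_ge0.
elim: J => [|J IH].
  (* The second summand is a primitive of - exp (- t) cos (u t). *)
  pose F : R -> R := (fun t => - expR (- t)) + (fun t => expR (- t)) *
    ((1 + u ^+ 2)^-1 *: ((fun t => cos (u * t)) - u *: (fun t => sin (u * t)))).
  have dF t : is_derive t 1 F (expR (- t) * cos_rem 1 (u * t)).
    have h1 : is_derive t 1 (fun t : R => u * t) u.
      have := is_deriveZ u (is_derive_id t 1).
      by move=> /is_derive_eq; apply; rewrite -[_ *: _]/(_ * _) mulr1.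
    have := is_deriveD (is_deriveN (is_derive_expRN t))
      (is_deriveM (is_derive_expRN t) (is_deriveZ (1 + u ^+ 2)^-1 (is_deriveB
        (is_derive1_comp (is_derive_cos _) h1)
        (is_deriveZ u (is_derive1_comp (is_derive_sin _) h1))))).
    move=> /is_derive_eq; apply; rewrite -![_ *: _]/(_ * _) /cos_rem/=.
    rewrite expr0 fact0.
    rewrite -[X in _ + (_ + X * _)]/((1 + u ^+ 2)^-1 *
      (cos (u * t) - u * sin (u * t))).
    by field.
  rewrite (@ge0_integral_primitive _ _ F 0 0)//.
  - rewrite /F !fctE /= -![_ *: _]/(_ * _) !mulr0 oppr0 expR0 cos0 sin0.
    by congr EFin; rewrite expr2 mulr0; field.
  - by move=> t; exact: ge0.
  - apply/cvgr0Pnorm_le => e e0.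
    (* The constant 3 comes from 1 + (1 + u) / (1 + u^2) <= 1 + 2. *)
    have : 3 * expR (- t) @[t --> +oo] --> (0 : R).
      by rewrite -(mulr0 3); apply: cvgMl_tmp; exact: cvgr_expR.
    move=> /cvgr0Pnorm_le/(_ _ e0); apply: filterS => t.
    apply: le_trans; rewrite normrM (ger0_norm (expR_ge0 _)) ger0_norm//.
    rewrite /F !fctE -![_ *: _]/(_ * _) -mulrN1 -mulrDr normrM.
    rewrite (ger0_norm (expR_ge0 _)) mulrC ler_wpM2r ?expR_ge0//.
    rewrite (le_trans (ler_normD _ _))// normrN1 -[leRHS]/(1 + 2 : R) lerD2l.
    rewrite normrM normfV (@ger0_norm _ (1 + _)) ?addr_ge0 ?sqr_ge0//.
    rewrite ler_pdivrMl; last by rewrite ltr_wpDr ?sqr_ge0.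
    rewrite (le_trans (ler_normB _ _))// normrM (ger0_norm u0).
    have c1 : `|cos (u * t)| <= 1 by rewrite ler_norml cos_geN1 cos_le1.
    have s1 : `|sin (u * t)| <= 1 by rewrite ler_norml sin_geN1 sin_le1.
    have : u * `|sin (u * t)| <= u * 1 by rewrite ler_wpM2l.
    by move: c1 => ? ?; nra.
rewrite (@integral_expRN_complement J.+1.*2 (u ^+ J.+1.*2)
  (u ^+ J.+1.*2 / (1 + u ^+ 2))
  (fun t => expR (- t) * cos_rem J.+1 (u * t)))//.
- by congr EFin; rewrite !doubleS !exprS; field.
- by move=> t; exact: ge0.
- by move=> t; exact: ge0.
- by rewrite exprn_ge0.
- by move=> t; rewrite (cos_remS J.+1) exprMn; ring.
Qed.

End laplace.

(** * Mellin transforms *)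

Section mellin.
Context {R : realType}.
Implicit Types (K G : R -> R) (a b c u v w t lam : R).
Local Notation mu := (@lebesgue_measure R).

Lemma ge0_integral_shift G c : continuous G -> (forall x, 0 <= G x) ->
  (\int[mu]_x (G x)%:E = \int[mu]_x (G (x + c))%:E)%E.
Proof.
move=> cG G0; pose F x : R := x + c.
have dF (x : R) : is_derive x 1 F (1 : R).
  have := is_deriveD (is_derive_id x (1 : R)) (is_derive_cst (c : R) x 1).
  by rewrite addr0.
have F'E : F^`()%classic = cst (1 : R) by apply/funext => x; rewrite derive1E; case: (dF x).
rewrite (@increasing_ge0_integration_by_substitutionT _ F)//.
- by apply: eq_integral => x _; rewrite F'E /= mulr1.
- by move=> x y xy; rewrite /F ltrD2r.
- by rewrite F'E; exact: cst_continuous.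
- by rewrite F'E; exact: is_cvg_cst.
- by rewrite F'E; exact: is_cvg_cst.
- apply/cvgrNyPle => A; near=> x; rewrite /F -lerBrDr.
  by near: x; apply: nbhs_ninfty_le; rewrite num_real.
- apply/cvgryPge => A; near=> x; rewrite /F -lerBlDr.
  by near: x; apply: nbhs_pinfty_ge; rewrite num_real.
Unshelve. all: by end_near. Qed.

Lemma integral_expR_itvcy b c : 0 < b ->
  (\int[mu]_(v in `[c, +oo[) (expR (- (b * v)))%:E =
   (expR (- (b * c)) / b)%:E)%E.
Proof.
move=> b0; pose F v := - (b^-1 * expR (- (b * v))).
have dF v : is_derive v 1 F (expR (- (b * v))).
  have h1 : is_derive v 1 (fun v : R => b * v) b.
    have := is_deriveZ b (is_derive_id v 1).
    by move=> /is_derive_eq; apply; rewrite -[_ *: _]/(_ * _) mulr1.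
  have := is_deriveN (is_deriveZ b^-1 (is_derive1_comp (is_derive_expRN _) h1)).
  move=> /is_derive_eq; apply; rewrite -![_ *: _]/(_ * _).
  by field; rewrite gt_eqF.
rewrite (@ge0_integral_primitive _ _ F c 0)//.
- by rewrite /F sub0r opprK mulrC.
- apply: (@continuous_compose _ (fun t => expR (- t)) ( *%R b)).
    exact: continuous_expRN.
  exact: mulrl_continuous.
- rewrite /F -oppr0; apply: cvgN; rewrite -(mulr0 b^-1); apply: cvgMl_tmp.
  apply: (@cvg_comp _ _ _ ( *%R b) (fun t => expR (- t)) _ (pinfty_nbhs R)).
    exact: gt0_cvgMry.
  exact: cvgr_expR.
Qed.

Lemma integral_expR_itvNyc a c : 0 < a ->
  (\int[mu]_(v in `]-oo, c]) (expR (a * v))%:E = (expR (a * c) / a)%:E)%E.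
Proof.
move=> a0; have cE : continuous (fun v => expR (a * v)).
  apply: (@continuous_compose _ expR ( *%R a)); first exact: continuous_expR.
  exact: mulrl_continuous.
rewrite -(opprK c) ge0_integration_by_substitutionNy.
- rewrite mulrN -integral_expR_itvcy//.
  by apply: eq_integral => x _; rewrite /= mulrN.
- exact: continuous_subspaceT.
- by move=> x _; exact: expR_ge0.
Qed.

(* [mellin K lam] is the integral of [K u * u `^ (- lam - 1)] over the positive
   half-line, written in the variable [v = ln u]; scaling becomes translation. *)
Definition mellin K lam : \bar R :=
  (\int[mu]_v (expR (- (lam * v)) * K (expR v))%:E)%E.

Lemma continuous_mellin_integrand K lam w : continuous K ->
  continuous (fun v => expR (- (lam * v)) * K (expR v * w)).
Proof.
move=> cK; apply: continuous_mul.
  apply: (@continuous_compose _ (fun t => expR (- t)) ( *%R lam)).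
    exact: continuous_expRN.
  exact: mulrl_continuous.
apply: (@continuous_compose _ K (fun v => expR v * w)); first exact: cK.
by move=> v; apply: cvgMr_tmp; exact: continuous_expR.
Qed.

(** Translating v by ln w turns exp (- lam v) into w^lam exp (- lam v). *)
Lemma mellin_scale K lam w : continuous K -> (forall u, 0 <= u -> 0 <= K u) ->
  0 < w ->
  (\int[mu]_v (expR (- (lam * v)) * K (expR v * w))%:E =
   (w `^ lam)%:E * mellin K lam)%E.
Proof.
move=> cK K0 w0; have cM x := @continuous_mellin_integrand K lam x cK.
have M0 x v : 0 <= x -> 0 <= expR (- (lam * v)) * K (expR v * x).
  by move=> x0; rewrite mulr_ge0 ?expR_ge0 ?K0// mulr_ge0 ?expR_ge0.
have cM1 : continuous (fun v => expR (- (lam * v)) * K (expR v)).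
  by have := cM 1; under eq_fun do rewrite mulr1.
have M01 v : 0 <= expR (- (lam * v)) * K (expR v).
  by have := M0 1 v ler01; rewrite mulr1.
rewrite /mellin (ge0_integral_shift (ln w) cM1 M01) -ge0_integralZl//.
- apply: eq_integral => v _; rewrite -EFinM; congr EFin.
  rewrite expRD lnK ?posrE// mulrA /powR gt_eqF// -expRD; congr (expR _ * _).
  by ring.
- apply/measurable_EFinP; apply: continuous_measurable_fun.
  apply: (@continuous_compose _ (fun v => expR (- (lam * v)) * K (expR v)) (+%R^~ (ln w))).
    exact: cM1.
  by move=> x; apply: cvgD; [exact: cvg_id|exact: cvg_cst].
- by move=> v _; rewrite lee_fin.
- by rewrite lee_fin powR_ge0.
Qed.

Lemma mellin_ge0 K lam : (forall u, 0 <= u -> 0 <= K u) -> (0 <= mellin K lam)%E.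
Proof.
by move=> K0; apply: integral_ge0 => v _; rewrite lee_fin mulr_ge0 ?K0 ?expR_ge0.
Qed.

(** Exchange the integrals and evaluate the one over v by [mellin_scale]. The weight [rho] is exp (-
    t) for the computation of the constant and 1 for the moments of psi. *)
Lemma mellin_tonelli d (T : measurableType d)
    (m : {sigma_finite_measure set T -> \bar R}) (D : set T) K (rho g : T -> R)
    lam :
  measurable D -> 0 < lam ->
  continuous K -> (forall u, 0 <= u -> 0 <= K u) -> K 0 = 0 ->
  measurable_fun D rho -> measurable_fun D g ->
  (forall x, D x -> 0 <= rho x) -> (forall x, D x -> 0 <= g x) ->
  (\int[m]_(x in D) (rho x * g x `^ lam)%:E * mellin K lam =
   \int[mu]_v ((expR (- (lam * v)))%:E *
     \int[m]_(x in D) (rho x * K (expR v * g x))%:E))%E.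
Proof.
(* Extending [rho] and [g] by 0 outside D reduces to integrals over the whole space. *)
move=> mD lam0 cK K0 K00 mrho mg rho0 g0.
have {mrho} mrho : measurable_fun setT (rho \_ D)
  by apply/(measurable_restrictT _ mD).
have {mg} mg : measurable_fun setT (g \_ D)
  by apply/(measurable_restrictT _ mD).
have {}rho0 x : 0 <= (rho \_ D) x.
  by rewrite patchE; case: ifPn => // /[!inE]; exact: rho0.
have {}g0 x : 0 <= (g \_ D) x.
  by rewrite patchE; case: ifPn => // /[!inE]; exact: g0.
have DE (F : R -> R) : (\int[m]_(x in D) (rho x * F (g x))%:E =
    \int[m]_x ((rho \_ D) x * F ((g \_ D) x))%:E)%E.
  rewrite integral_mkcond; apply: eq_integral => x _.
  by rewrite !patchE; case: ifPn => // _; rewrite mul0r.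
rewrite (DE (fun y => y `^ lam)).
under [RHS]eq_integral do rewrite (DE (fun y => K (expR _ * y))).
move: (rho \_ D) (g \_ D) mrho mg rho0 g0 => {DE mD D g}rho g mrho mg rho0 g0.
have mK : measurable_fun setT K by exact: continuous_measurable_fun.
pose f (z : T * R) := (expR (- (lam * z.2)) * (rho z.1 * K (expR z.2 * g z.1)))%:E.
have mf : measurable_fun setT f.
  have m2 : measurable_fun setT (fun z : T * R => z.2) by exact: measurable_snd.
  have mg1 : measurable_fun setT (fun z : T * R => g z.1).
    exact: (measurableT_comp mg measurable_fst).
  have mr1 : measurable_fun setT (fun z : T * R => rho z.1).
    exact: (measurableT_comp mrho measurable_fst).
  have mN : measurable_fun setT (fun z : T * R => - (lam * z.2)).
    by apply: measurableT_comp => //; exact: measurable_funM.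
  apply/measurable_EFinP; apply: measurable_funM.
    exact: (measurableT_comp (@measurable_expR R) mN).
  apply: measurable_funM => //.
  have mE : measurable_fun setT (fun z : T * R => expR z.2 * g z.1).
    apply: measurable_funM => //.
    exact: (measurableT_comp (@measurable_expR R) m2).
  exact: (measurableT_comp mK mE).
have Kg0 x v : 0 <= K (expR v * g x) by rewrite K0// mulr_ge0 ?expR_ge0.
have f0 z : (0 <= f z)%E by rewrite lee_fin !mulr_ge0 ?expR_ge0.
rewrite -ge0_integralZr//; first last.
- exact: mellin_ge0.
- by move=> x _; rewrite lee_fin mulr_ge0 ?powR_ge0.
- apply/measurable_EFinP; apply: measurable_funM => //.
  exact: (measurableT_comp (measurable_powR _) mg).
transitivity (\int[m]_x \int[mu]_v f (x, v))%E.
  apply: eq_integral => x _; rewrite EFinM -muleA.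
  transitivity (\int[mu]_v ((rho x)%:E * (expR (- (lam * v)) * K (expR v * g x))%:E))%E.
    rewrite ge0_integralZl//; first last.
    - by rewrite lee_fin.
    - by move=> v _; rewrite lee_fin mulr_ge0 ?expR_ge0.
    - apply/measurable_EFinP; apply: continuous_measurable_fun.
      exact: continuous_mellin_integrand.
    (* Scaling requires g x > 0; where g x = 0, both sides vanish because K 0 = 0 and 0^lam = 0. *)
    congr (_ * _)%E; have := g0 x; rewrite le_eqVlt => /predU1P[<-|gx].
      rewrite powR0 ?gt_eqF// mul0e integral0_eq// => v _.
      by rewrite mulr0 K00 mulr0.
    by rewrite mellin_scale.
  by apply: eq_integral => v _; rewrite /f /= -EFinM; congr EFin; ring.
transitivity (\int[mu]_v \int[m]_x f (x, v))%E.
  exact: (@fubini_tonelli _ _ _ _ _ m mu f mf f0).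
apply: eq_integral => v _.
rewrite -ge0_integralZl//.
- apply/measurable_EFinP; apply: measurable_funM => //.
  apply: (measurableT_comp mK); apply: measurable_funM => //.
- by move=> x _; rewrite lee_fin mulr_ge0.
Qed.

End mellin.

(** * The moment constant *)

Section moment_constant.
Context {R : realType}.
Implicit Types (a b c u v w t lam : R) (J : nat).
Local Notation mu := (@lebesgue_measure R).

Lemma ge0_integral_split (f : R -> R) c : measurable_fun setT f ->
  (forall v, 0 <= f v) ->
  (\int[mu]_v (f v)%:E =
   \int[mu]_(v in `]-oo, c]) (f v)%:E + \int[mu]_(v in `[c, +oo[) (f v)%:E)%E.
Proof.
move=> mf f0.
have mfD (D : set R) : measurable_fun D (fun v => (f v)%:E).
  by apply/measurable_EFinP; exact: measurable_funTS.
rewrite -(setUv `]-oo, c]%classic) ge0_integral_setU//=.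
- by rewrite setCitvl integral_itv_obnd_cbnd.
- exact: measurableC.
- exact: mfD.
- by move=> v _; rewrite lee_fin.
- exact/disj_setPCl.
Qed.

Lemma integral_gamma_kernel lam :
  (\int[mu]_(t in `]0%R, +oo[) (expR (- t) * t `^ lam)%:E =
   \int[mu]_(t in `]0%R, +oo[) (t `^ (lam + 1 - 1) * expR (- t))%:E)%E.
Proof. by apply: eq_integral => t _; rewrite addrK mulrC. Qed.

(** The Mellin transform of the common Laplace transform u^(2J+2) / (1 + u^2), through which the
    cosine and Gaussian kernels are compared. *)
Definition laplace_mellin J lam : \bar R :=
  (\int[mu]_v (expR (- (lam * v)) *
     (expR v ^+ J.+1.*2 / (1 + expR v ^+ 2)))%:E)%E.

Lemma continuous_exp_rem_sq J : continuous (fun u => exp_rem J (u ^+ 2 / 2)).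
Proof.
apply: (@continuous_compose _ (exp_rem J) (fun u => u ^+ 2 / 2)).
  exact: continuous_exp_rem.
by move=> u; apply: cvgMr_tmp; exact: exprn_continuous.
Qed.

Lemma exp_rem_sq_ge0 J u : 0 <= exp_rem J (u ^+ 2 / 2).
Proof. by rewrite exp_rem_ge0// divr_ge0 ?sqr_ge0. Qed.

(** Tonelli with weight exp (- t) and g t = t: integrating in v first gives the left side, in t
    first the Laplace transform. *)
Lemma mellin_cos_rem J lam : 0 < lam ->
  (\int[mu]_(t in `]0%R, +oo[) (t `^ (lam + 1 - 1) * expR (- t))%:E *
   mellin (cos_rem J.+1) lam = laplace_mellin J lam)%E.
Proof.
move=> lam0; rewrite -integral_gamma_kernel.
rewrite (@mellin_tonelli _ _ _ mu _ (cos_rem J.+1) (fun t => expR (- t)) id)//.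
- apply: eq_integral => v _; rewrite integral_itv_obnd_cbnd.
    by rewrite laplace_cos_rem ?expR_ge0// -EFinM.
  apply: continuous_measurable_itv; apply: continuous_mul.
    exact: continuous_expRN.
  apply: (@continuous_compose _ (cos_rem J.+1) ( *%R (expR v))).
    exact: continuous_cos_rem.
  exact: mulrl_continuous.
- exact: continuous_cos_rem.
- by move=> u u0; exact: cos_rem_ge0.
- exact: cos_rem0.
- apply: measurable_funTS; apply: continuous_measurable_fun.
  exact: continuous_expRN.
- by move=> t /=; rewrite in_itv/= andbT; exact: ltW.
Qed.

Lemma mellin_exp_rem J lam : 0 < lam ->
  (\int[mu]_(t in `]0%R, +oo[) (t `^ (lam / 2 + 1 - 1) * expR (- t))%:E *
   (2 `^ (lam / 2))%:E * mellin (fun u => exp_rem J.+1 (u ^+ 2 / 2)) lam =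
   laplace_mellin J lam)%E.
Proof.
move=> lam0; rewrite -integral_gamma_kernel.
have mD : measurable (`]0%R, +oo[%classic : set R) by exact: measurable_itv.
rewrite -ge0_integralZr//; last first.
- by move=> t _; rewrite lee_fin mulr_ge0 ?powR_ge0 ?expR_ge0.
- apply/measurable_EFinP; apply: measurable_funM.
    apply: measurable_funTS; apply: continuous_measurable_fun.
    exact: continuous_expRN.
  by apply: measurable_funTS; exact: measurable_powR.
have pos t : `]0%R, +oo[%classic t -> 0 < t :> R by rewrite /= in_itv/= andbT.
(* Here g t is the square root of 2 t: then (u g)^2 / 2 = u^2 t, and g^lam supplies the factor
   2^(lam/2). *)
transitivity (\int[mu]_(t in `]0%R, +oo[)
    (expR (- t) * ((2 * t) `^ 2^-1) `^ lam)%:E *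
    mellin (fun u => exp_rem J.+1 (u ^+ 2 / 2)) lam)%E.
  congr (_ * _)%E; apply: eq_integral => t /[!inE] /pos t0.
  rewrite -EFinM; congr EFin; rewrite -mulrA; congr (_ * _).
  by rewrite -powRrM mulrC powRM ?ltW// [2^-1 * _]mulrC mulrC.
rewrite mellin_tonelli//.
- apply: eq_integral => v _; rewrite EFinM -laplace_exp_rem.
  rewrite -integral_itv_obnd_cbnd; last first.
    apply: continuous_measurable_itv; apply: continuous_mul.
      exact: continuous_expRN.
    apply: (@continuous_compose _ (exp_rem J.+1) ( *%R (expR v ^+ 2))).
      exact: continuous_exp_rem.
    exact: mulrl_continuous.
  congr (_ * _)%E; apply: eq_integral => t /[!inE] /pos t0.
  congr (EFin (_ * exp_rem _ _)).
  rewrite exprMn -[_ `^ _ ^+ 2]powR_mulrn ?powR_ge0// -powRrM mulVf ?pnatr_eq0//.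
  by rewrite powRr1 ?mulr_ge0 ?ltW//; field.
- exact: continuous_exp_rem_sq.
- by move=> u _; exact: exp_rem_sq_ge0.
- by rewrite expr0n mul0r exp_rem0.
- apply: measurable_funTS; apply: continuous_measurable_fun.
  exact: continuous_expRN.
- apply: measurable_funTS; apply: (measurableT_comp (measurable_powR _)).
  exact: measurable_funM.
- by move=> t _; exact: powR_ge0.
Qed.

(** The integrand decays like exp ((2J+2 - lam) v) at minus infinity and like exp (- (lam - 2J) v)
    at plus infinity; this is where the open strip for lam is used. *)
Lemma laplace_mellin_fin J lam : J.*2%:R < lam < J.+1.*2%:R ->
  (0 < laplace_mellin J lam < +oo)%E.
Proof.
move=> /andP[lam1 lam2].
have lam0 : 0 < lam by rewrite (le_lt_trans _ lam1).
pose f v := expR (- (lam * v)) * (expR v ^+ J.+1.*2 / (1 + expR v ^+ 2)).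
have e1 v : 0 < 1 + expR v ^+ 2 by rewrite ltr_wpDr ?sqr_ge0.
have f0 v : 0 <= f v.
  by rewrite mulr_ge0 ?expR_ge0// divr_ge0 ?exprn_ge0 ?expR_ge0// ltW.
have cX n : continuous (fun v : R => expR v ^+ n).
  apply: (@continuous_compose _ (fun u => u ^+ n) expR).
    exact: exprn_continuous.
  exact: continuous_expR.
have cf : continuous f.
  apply: continuous_mul.
    apply: (@continuous_compose _ (fun t => expR (- t)) ( *%R lam)).
      exact: continuous_expRN.
    exact: mulrl_continuous.
  move=> v; apply: cvgM; first exact: cX.
  apply: cvgV; first exact: lt0r_neq0.
  by apply: cvgD; [exact: cvg_cst|exact: cX].
have mfD (D : set R) : measurable_fun D (fun v => (f v)%:E).
  apply/measurable_EFinP; apply: measurable_funTS.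
  exact: continuous_measurable_fun.
have m2fD (D : set R) : measurable_fun D (fun v => (2 * f v)%:E).
  apply/measurable_EFinP; apply: measurable_funM => //.
  by apply: measurable_funTS; exact: continuous_measurable_fun.
have mE (h : R) (D : set R) : measurable_fun D (fun v => (expR (h * v))%:E).
  apply/measurable_EFinP; apply: measurable_funTS.
  apply: continuous_measurable_fun.
  apply: (@continuous_compose _ expR ( *%R h)); first exact: continuous_expR.
  exact: mulrl_continuous.
have mN (h : R) (D : set R) : measurable_fun D (fun v => (expR (- (h * v)))%:E).
  apply/measurable_EFinP; apply: measurable_funTS.
  apply: continuous_measurable_fun.
  apply: (@continuous_compose _ (fun t => expR (- t)) ( *%R h)).
    exact: continuous_expRN.
  exact: mulrl_continuous.
rewrite /laplace_mellin -/f; apply/andP; split.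
(* For v >= 0 and u = exp v, u^(2J+2) / (1 + u^2) >= 1/2, so 2 f dominates exp (- lam v). *)
- have h : ((expR (- (lam * 0)) / lam)%:E <= 2%:E * \int[mu]_v (f v)%:E)%E.
    rewrite -integral_expR_itvcy//.
    have -> : (2%:E * \int[mu]_v (f v)%:E = \int[mu]_v (2 * f v)%:E)%E.
      under [RHS]eq_integral do rewrite EFinM.
      rewrite ge0_integralZl//; first exact: mfD.
      by move=> v _; rewrite lee_fin.
    apply: (@le_trans _ _ (\int[mu]_(v in `[0%R, +oo[) (2 * f v)%:E)%E); last first.
      apply: ge0_subset_integral => //.
      - exact: m2fD.
      - by move=> v _; rewrite lee_fin mulr_ge0.
    apply: ge0_le_integral => //.
    - exact: mN.
    - exact: m2fD.
    move=> v /=; rewrite in_itv/= andbT => v0; rewrite lee_fin /f.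
    rewrite mulrCA ler_peMr ?expR_ge0// mulrA ler_pdivlMr// mul1r.
    have ev : 1 <= expR v by rewrite -expR0 ler_expR.
    have : expR v ^+ 2 <= expR v ^+ J.+1.*2 by rewrite ler_weXn2l.
    have : 1 <= expR v ^+ 2 by rewrite exprn_ege1.
    by lra.
  rewrite lt_neqAle integral_ge0 ?andbT//; apply/eqP => H0; move: h.
  rewrite -H0 mule0 lee_fin mulr0 oppr0 expR0 mul1r leNgt.
  by rewrite invr_gt0 lam0.
- rewrite (@ge0_integral_split f 0)//; last exact: continuous_measurable_fun.
  have a0 : 0 < J.+1.*2%:R - lam by rewrite subr_gt0.
  have b0 : 0 < lam - J.*2%:R by rewrite subr_gt0.
  apply: (@le_lt_trans _ _ (\int[mu]_(v in `]-oo, 0%R]) (expR ((J.+1.*2%:R - lam) * v))%:E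
    + \int[mu]_(v in `[0%R, +oo[) (expR (- ((lam - J.*2%:R) * v)))%:E)%E); last first.
    by rewrite integral_expR_itvcy// integral_expR_itvNyc// ltry.
  have up1 (v : R) : f v <= expR ((J.+1.*2%:R - lam) * v).
    rewrite /f (_ : (J.+1.*2%:R - lam) * v = - (lam * v) + J.+1.*2%:R * v); last by ring.
    rewrite expRD ler_wpM2l ?expR_ge0//.
    rewrite expRM_natl ler_pdivrMr// ler_peMr ?exprn_ge0 ?expR_ge0//.
    by rewrite lerDl sqr_ge0.
  have up2 (v : R) : f v <= expR (- ((lam - J.*2%:R) * v)).
    rewrite /f (_ : - ((lam - J.*2%:R) * v) = - (lam * v) + J.*2%:R * v); last by ring.
    rewrite expRD ler_wpM2l ?expR_ge0//.
    rewrite expRM_natl ler_pdivrMr// doubleS -addn2 exprD.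
    by rewrite ler_pM2l ?exprn_gt0 ?expR_gt0// lerDr.
  have f0D (D : set R) v : D v -> (0 <= (f v)%:E)%E by rewrite lee_fin.
  apply: leeD; apply: ge0_le_integral => //; try exact: f0D.
  - exact: mfD.
  - exact: mE.
  - by move=> v _; rewrite lee_fin up1.
  - exact: mfD.
  - exact: mN.
  - by move=> v _; rewrite lee_fin up2.
Qed.

(** A zero factor would make the product 0, and an infinite one 0 or infinite. Finiteness of the
    Gamma integrals and of the Mellin transforms is thus read off their product. *)
Lemma mule_fin_pos (x y : \bar R) : (0 <= x -> 0 <= y -> 0 < x * y < +oo ->
  [/\ x = (fine x)%:E, y = (fine y)%:E, 0 < fine x & 0 < fine y]%R)%E.
Proof.
move: x y => [x| |] [y| |]//=; rewrite ?lee_fin.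
- move=> x0 y0; rewrite -EFinM lte_fin => /andP[xy _]; split => //.
  + by rewrite lt_neqAle x0 andbT; apply: contraTneq xy => <-; rewrite mul0r ltxx.
  + by rewrite lt_neqAle y0 andbT; apply: contraTneq xy => <-; rewrite mulr0 ltxx.
- rewrite le_eqVlt => /predU1P[<- _|x0 _]; first by rewrite mul0e ltxx.
  by rewrite gt0_muley ?lte_fin// ltxx andbF.
- move=> _; rewrite le_eqVlt => /predU1P[<-|y0]; first by rewrite mule0 ltxx.
  by rewrite gt0_mulye ?lte_fin// ltxx andbF.
- by move=> _ _; rewrite mulyy ltxx andbF.
Qed.

(** Gamma (lam + 1) k1 and Gamma (lam/2 + 1) 2^(lam/2) k2 both equal [laplace_mellin J lam], which
    is finite and positive. *)
Lemma Gamma_ratio J lam : J.*2%:R < lam < J.+1.*2%:R ->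
  exists k1 k2 : R, [/\ 0 < k1, mellin (cos_rem J.+1) lam = k1%:E,
    mellin (fun u => exp_rem J.+1 (u ^+ 2 / 2)) lam = k2%:E &
    Gamma (lam + 1) / (Gamma (lam / 2 + 1) * 2 `^ (lam / 2)) = k2 / k1].
Proof.
move=> lamJ; have lam0 : 0 < lam.
  by case/andP: lamJ => + _; apply: le_lt_trans.
have := laplace_mellin_fin lamJ; rewrite -(mellin_cos_rem J lam0) => h1.
have := laplace_mellin_fin lamJ; rewrite -(mellin_exp_rem J lam0) => h2.
have := mellin_cos_rem J lam0; rewrite -(mellin_exp_rem J lam0).
have G0 (s : R) : (0 <= \int[mu]_(t in `]0%R, +oo[)
    (t `^ (s - 1) * expR (- t))%:E)%E.
  by apply: integral_ge0 => t _; rewrite lee_fin mulr_ge0 ?powR_ge0 ?expR_ge0.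
have c0 : (0 <= mellin (cos_rem J.+1) lam)%E.
  by apply: mellin_ge0 => u u0; exact: cos_rem_ge0.
have e0 : (0 <= mellin (fun u => exp_rem J.+1 (u ^+ 2 / 2)) lam)%E.
  by apply: mellin_ge0 => u u0; exact: exp_rem_sq_ge0.
have [eq1 eq2 g1 k1] := mule_fin_pos (G0 _) c0 h1.
rewrite -muleA in h2.
have p0 : (0 <= (2 `^ (lam / 2))%:E :> \bar R)%E by rewrite lee_fin powR_ge0.
have [eq3 eq4 g2 y0] := mule_fin_pos (G0 _) (mule_ge0 p0 e0) h2.
have p1 : 0 < 2 `^ (lam / 2) :> R by rewrite powR_gt0.
have h3 : (0 < (2 `^ (lam / 2))%:E * mellin (fun u => exp_rem J.+1 (u ^+ 2 / 2)) lam < +oo)%E.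
  by rewrite eq4 lte_fin ltry y0.
have [_ eq5 _ _] := mule_fin_pos p0 e0 h3.
rewrite eq1 eq2 eq3 eq5 -!EFinM => -[E].
exists (fine (mellin (cos_rem J.+1) lam)),
  (fine (mellin (fun u => exp_rem J.+1 (u ^+ 2 / 2)) lam)); split => //.
rewrite /Gamma /Rintegral; apply/eqP; rewrite eqr_div.
- by apply/eqP; rewrite E; ring.
- by rewrite gt_eqF// mulr_gt0.
- by rewrite gt_eqF.
Qed.

End moment_constant.

(** * Comparison of absolute moments *)

Section comparison.
Context {R : realType}.
Implicit Types (a b c u v w t lam : R) (J : nat).
Local Notation mu := (@lebesgue_measure R).

(** One-sided and stated in the extended reals, so it can be applied in both directions before the
    integrals are known to be finite. *)
Lemma ge0_integral_close (f g : R -> R) (P Q a b c : R) :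
  measurable_fun setT f -> measurable_fun setT g ->
  (forall v, 0 <= f v) -> (forall v, 0 <= g v) ->
  0 < a -> 0 < b -> 0 <= P -> 0 <= Q ->
  (forall v, v <= c -> f v <= g v + P * expR (a * v)) ->
  (forall v, c <= v -> f v <= g v + Q * expR (- (b * v))) ->
  (\int[mu]_v (f v)%:E <= \int[mu]_v (g v)%:E +
     (P * (expR (a * c) / a) + Q * (expR (- (b * c)) / b))%:E)%E.
Proof.
move=> mf mg f0 g0 a0 b0 P0 Q0 fP fQ.
have EFinm (h : R -> R) (D : set R) : measurable_fun setT h ->
    measurable_fun D (fun v => (h v)%:E).
  by move=> mh; apply/measurable_EFinP; exact: measurable_funTS.
have mE (h : R) : measurable_fun setT (fun v => expR (h * v)).
  apply: continuous_measurable_fun.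
  apply: (@continuous_compose _ expR ( *%R h)); first exact: continuous_expR.
  exact: mulrl_continuous.
have mN (h : R) : measurable_fun setT (fun v => expR (- (h * v))).
  apply: continuous_measurable_fun.
  apply: (@continuous_compose _ (fun t => expR (- t)) ( *%R h)).
    exact: continuous_expRN.
  exact: mulrl_continuous.
have half (D : set R) (h : R -> R) (Z : R) : measurable D -> 0 <= Z ->
    measurable_fun setT h -> (forall v, 0 <= h v) ->
    (forall v, D v -> f v <= g v + Z * h v) ->
    (\int[mu]_(v in D) (f v)%:E <=
      \int[mu]_(v in D) (g v)%:E + Z%:E * \int[mu]_(v in D) (h v)%:E)%E.
  move=> mD Z0 mh h0 fZ; rewrite -ge0_integralZl//; last first.
  - by move=> v _; rewrite lee_fin.
  - exact: EFinm.
  have mZh : measurable_fun setT (fun v => Z * h v) by exact: measurable_funM.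
  rewrite -ge0_integralD//; last first.
  - exact: (EFinm (fun v => Z * h v)).
  - by move=> v _; rewrite lee_fin mulr_ge0.
  - exact: EFinm.
  - by move=> v _; rewrite lee_fin.
  apply: ge0_le_integral.
  - exact: mD.
  - by move=> v _; rewrite lee_fin.
  - exact: EFinm.
  - apply: (EFinm (fun v => g v + Z * h v)); exact: measurable_funD.
  - by move=> v Dv; rewrite -EFinM -EFinD lee_fin fZ.
rewrite (ge0_integral_split c mf f0) (ge0_integral_split c mg g0) EFinD (EFinM P) (EFinM Q).
rewrite -integral_expR_itvNyc// -integral_expR_itvcy// [X in (_ <= X)%E]addeACA.
apply: leeD.
- apply: (half _ (fun v => expR (a * v))) => //.
- apply: (half _ (fun v => expR (- (b * v)))) => //.
  by move=> v; rewrite /= in_itv/= andbT; exact: fQ.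
Qed.

(** Tonelli's measurability of partial integrals, applied to the integrand multiplied by the
    indicator of D. *)
Lemma measurable_kernel_integral d (T : measurableType d)
    (m : {sigma_finite_measure set T -> \bar R}) (D : set T) (K : R -> R)
    (g : T -> R) :
  measurable D -> measurable_fun setT K -> (forall u, 0 <= u -> 0 <= K u) ->
  measurable_fun D g -> (forall x, D x -> 0 <= g x) ->
  measurable_fun setT (fun v => (\int[m]_(x in D) (K (expR v * g x))%:E)%E).
Proof.
move=> mD mK K0 mg g0.
have {mg} mg : measurable_fun setT (g \_ D).
  by apply/(measurable_restrictT _ mD).
pose f (z : T * R) := (\1_D z.1 * K (expR z.2 * (g \_ D) z.1))%:E.
have g0' x : 0 <= (g \_ D) x.
  by rewrite patchE; case: ifPn => // /[!inE]; exact: g0.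
have mf : measurable_fun setT f.
  have m2 : measurable_fun setT (fun z : T * R => z.2) by exact: measurable_snd.
  have mg1 : measurable_fun setT (fun z : T * R => (g \_ D) z.1).
    exact: (measurableT_comp mg measurable_fst).
  have m11 : measurable_fun setT (fun z : T * R => \1_D z.1 : R).
    by apply: (measurableT_comp _ measurable_fst); exact: measurable_indic.
  apply/measurable_EFinP; apply: measurable_funM => //.
  have mE : measurable_fun setT (fun z : T * R => expR z.2 * (g \_ D) z.1).
    apply: measurable_funM => //.
    exact: (measurableT_comp (@measurable_expR R) m2).
  exact: (measurableT_comp mK mE).
have f0 z : (0 <= f z)%E by rewrite lee_fin mulr_ge0// K0// mulr_ge0 ?expR_ge0.
have := @measurable_fun_fubini_tonelli_G _ _ _ _ _ m f mf f0.
apply: eq_measurable_fun => v _; rewrite /fubini_G [RHS]integral_mkcond.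
apply: eq_integral => x _; rewrite /f /= !patchE indicE.
by case: ifPn => xD; rewrite ?mul1r ?mul0r.
Qed.

Lemma ge0_bounded_integral_fin d (T : measurableType d)
    (m : {measure set T -> \bar R}) (D : set T) (f : T -> R) c :
  measurable D -> (m D < +oo)%E -> measurable_fun D f ->
  (forall x, D x -> 0 <= f x <= c) ->
  (\int[m]_(x in D) (f x)%:E <= c%:E * m D)%E /\
  (\int[m]_(x in D) (f x)%:E)%E \is a fin_num.
Proof.
move=> mD mDy mf fc.
have le : (\int[m]_(x in D) (f x)%:E <= c%:E * m D)%E.
  rewrite -integral_cst//; apply: ge0_le_integral.
  - exact: mD.
  - by move=> x /fc /andP[? _]; rewrite lee_fin.
  - exact/measurable_EFinP.
  - exact: measurable_cst.
  - by move=> x /fc /andP[_ ?]; rewrite lee_fin.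
split => //; rewrite ge0_fin_numE; last first.
  by apply: integral_ge0 => x /fc /andP[? _]; rewrite lee_fin.
have [D0|D0] := leP c 0; first rewrite (le_lt_trans le)// (@le_lt_trans _ _ 0%E)//.
  by rewrite mule_le0_ge0// lee_fin.
by rewrite (le_lt_trans le)// lte_mul_pinfty// lee_fin ltW.
Qed.

End comparison.

(** * From even moments to kernel averages *)

Section moment_comparison.
Context {R : realType}.
Implicit Types (a b c u v w t lam X U delta : R) (j J N k : nat).
Local Notation mu := (@lebesgue_measure R).

(** The moment of order 2j of the standard normal law, that is (2j - 1)!!. *)
Definition gauss_moment j : R := j.*2`!%:R / (j`!%:R * 2 ^+ j).

Lemma gauss_moment_ge0 j : 0 <= gauss_moment j.
Proof. by rewrite /gauss_moment divr_ge0 ?mulr_ge0 ?exprn_ge0. Qed.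

Lemma fact_neq0 j : j`!%:R != 0 :> R.
Proof. by rewrite pnatr_eq0 -lt0n fact_gt0. Qed.

Lemma exprn_le_fact_expR j U : 0 <= U -> U ^+ j / j`!%:R <= expR U.
Proof.
move=> U0; case: j => [|j].
  by rewrite expr0 fact0 divr1; have := expR_ge1Dx U; lra.
by have := expR_ge1Dxn j U0; lra.
Qed.

(** In the application [phi j] is the integral of [cos_rem j (u g)] and [M j] the moment of order 2j
    of g. The factor u^(2k) is kept outside the bound to make it integrable against the Mellin
    weight near u = 0. *)
Lemma kernel_closeness (phi M : nat -> R) k N X U u delta : (k <= N)%N ->
  0 <= X -> 0 <= delta -> 0 < u <= U -> 1 <= U ->
  (forall j, (k <= j)%N -> 0 <= phi j) ->
  (forall j, (k <= j)%N -> phi j + phi j.+1 = u ^+ j.*2 / j.*2`!%:R * M j) ->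
  (forall j, (k <= j <= N)%N -> `|M j - X * gauss_moment j| <= X * delta) ->
  `|phi k - X * exp_rem k (u ^+ 2 / 2)| <=
    X * u ^+ k.*2 * (delta * N.+1%:R * expR U + (U ^+ 2 / 2) ^+ N / N`!%:R).
Proof.
move=> kN X0 d0 /andP[u0 uU] U1 phi0 phiD MX.
have U0 : 0 <= U by rewrite (le_trans _ uU)// ltW.
have uX j : (k <= j)%N -> u ^+ j.*2 <= u ^+ k.*2 * U ^+ j.*2.
  move=> kj; rewrite -(subnKC kj) doubleD [leLHS]exprD.
  rewrite ler_pM2l ?exprn_gt0// (@le_trans _ _ (U ^+ (j - k).*2))//.
    by apply: lerXn2r; rewrite ?nnegrE// ltW.
  by rewrite ler_weXn2l// leq_addl.
(* Gaussian moments turn the cosine coefficients into those of exp (- u^2 / 2). *)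
pose q j := X * ((u ^+ 2 / 2) ^+ j / j`!%:R).
have qE j : q j = u ^+ j.*2 / j.*2`!%:R * (X * gauss_moment j).
  rewrite /q /gauss_moment expr_div_n -exprM mul2n.
  by field; rewrite !fact_neq0 expf_neq0.
have qD j : X * exp_rem j (u ^+ 2 / 2) + X * exp_rem j.+1 (u ^+ 2 / 2) = q j.
  by rewrite exp_remS /q; ring.
have h1 : forall j, (k <= j)%N -> 0 <= phi j /\ 0 <= X * exp_rem j (u ^+ 2 / 2).
  move=> j kj; split; first exact: phi0.
  by rewrite mulr_ge0// exp_rem_ge0// divr_ge0 ?sqr_ge0.
have h2 : forall j, (k <= j <= N)%N ->
    phi j + phi j.+1 = u ^+ j.*2 / j.*2`!%:R * M j /\
    X * exp_rem j (u ^+ 2 / 2) + X * exp_rem j.+1 (u ^+ 2 / 2) = q j.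
  by move=> j /andP[kj _]; split; [exact: phiD|exact: qD].
apply: le_trans (alternating_closeness kN h1 h2) _ => {h1 h2}.
rewrite [leRHS]mulrDr; apply: lerD.
  apply: (@le_trans _ _ (\sum_(k <= j < N.+1) X * u ^+ k.*2 * (delta * expR U))).
    rewrite big_nat_cond [leRHS]big_nat_cond; apply: ler_sum => j.
    rewrite andbT => /andP[kj]; rewrite ltnS => jN.
    rewrite qE -mulrBr normrM ger0_norm; last first.
      by rewrite divr_ge0 ?exprn_ge0// ltW.
    (* The factorial absorbs the power of U: U^(2j) / (2j)! <= exp U for every j. *)
    have h1 : u ^+ j.*2 / j.*2`!%:R <= u ^+ k.*2 * expR U.
      rewrite (@le_trans _ _ (u ^+ k.*2 * U ^+ j.*2 / j.*2`!%:R))//.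
        by rewrite ler_pM2r ?invr_gt0 ?ltr0n ?fact_gt0// uX.
      by rewrite -mulrA ler_pM2l ?exprn_gt0// exprn_le_fact_expR.
    rewrite (le_trans (ler_pM _ _ h1 (MX j _)))//.
    - by rewrite divr_ge0 ?exprn_ge0// ltW.
    - by rewrite kj.
    - by rewrite le_eqVlt; apply/orP; left; apply/eqP; ring.
  rewrite big_const_nat iter_addr_0 -[leLHS]mulr_natr.
  have -> : X * u ^+ k.*2 * (delta * N.+1%:R * expR U) =
    X * u ^+ k.*2 * (delta * expR U) * N.+1%:R by ring.
  apply: ler_wpM2l; last by rewrite ler_nat leq_subr.
  by rewrite !mulr_ge0 ?exprn_ge0 ?expR_ge0// ltW.
rewrite /q -mulrA ler_wpM2l// !expr_div_n -!exprM !mul2n.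
rewrite !mulrA ler_pM2r ?invr_gt0 ?ltr0n ?fact_gt0//.
by rewrite ler_pM2r ?invr_gt0 ?exprn_gt0// uX.
Qed.

Lemma exp_rem_sq_le J X u : 0 <= X -> 0 <= u ->
  X * exp_rem J.+1 (u ^+ 2 / 2) <= X * u ^+ J.*2.
Proof.
move=> X0 u0; rewrite ler_wpM2l// (le_trans (exp_rem_le _ _))//.
  by rewrite divr_ge0 ?sqr_ge0.
rewrite expr_div_n -exprM mul2n ler_pdivrMr ?exprn_gt0// ler_peMr ?exprn_ge0//.
by rewrite exprn_ege1// ler1n.
Qed.

End moment_comparison.

(** * From even moments to absolute moments *)

Section abs_moment_comparison.
Context {R : realType}.
Implicit Types (a b c u v w t lam X U delta : R) (j J N k : nat).
Local Notation mu := (@lebesgue_measure R).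

(** k1 times the absolute moment and k2 X are Mellin integrals of [phi J.+1] and of X times the
    Gaussian kernel. Up to v = c their integrands are compared by [kernel_closeness] with U = exp c,
    beyond it by size alone. The bound [bd] guarantees finite integrals. *)
Lemma abs_moment_comparison d (T : measurableType d)
    (m : {sigma_finite_measure set T -> \bar R}) (D : set T) (g : T -> R)
    (bd : R) J N X c delta lam (k1 k2 : R) :
  measurable D -> measurable_fun D g -> (forall x, D x -> 0 <= g x <= bd) ->
  (m D <= X%:E)%E -> 0 <= X -> 0 <= delta -> 0 <= c -> (J < N)%N ->
  J.*2%:R < lam < J.+1.*2%:R -> 0 < k1 ->
  mellin (cos_rem J.+1) lam = k1%:E ->
  mellin (fun u => exp_rem J.+1 (u ^+ 2 / 2)) lam = k2%:E ->
  (forall j, (J < j <= N)%N ->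
    `|fine (\int[m]_(x in D) (g x ^+ j.*2)%:E)%E - X * gauss_moment j|
      <= X * delta) ->
  forall a b p q, a = J.+1.*2%:R - lam -> b = lam - J.*2%:R ->
  p = delta * N.+1%:R * expR (expR c) + (expR c ^+ 2 / 2) ^+ N / N`!%:R ->
  q = 2 * (1 + gauss_moment J.+1 + delta) + 1 ->
  `|k1 * fine (\int[m]_(x in D) (g x `^ lam)%:E)%E - k2 * X| <=
    X * p * (expR (a * c) / a) + X * q * (expR (- (b * c)) / b).
Proof.
move=> mD mg gb mDX X0 d0 c0 JN lamJ k10 mk1 mk2 MX a b p q aE bE pE qE.
have lam0 : 0 < lam by case/andP: lamJ => + _; apply: le_lt_trans.
have a0 : 0 < a by rewrite aE subr_gt0; case/andP: lamJ.
have b0 : 0 < b by rewrite bE subr_gt0; case/andP: lamJ.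
have mDy : (m D < +oo)%E by rewrite (le_lt_trans mDX)// ltry.
have g0 x : D x -> 0 <= g x by move=> /gb /andP[].
have mcos j : measurable_fun setT (@cos_rem R j).
  by apply: continuous_measurable_fun; exact: continuous_cos_rem.
have mgX j : measurable_fun D (fun x => g x ^+ j) by exact: measurable_funX.
have mgE v : measurable_fun D (fun x => expR v * g x).
  exact: measurable_funM.
have mcg j v : measurable_fun D (fun x => cos_rem j (expR v * g x)).
  exact: (measurableT_comp (mcos j) (mgE v)).
have eg0 v x : D x -> 0 <= expR v * g x.
  by move=> Dx; rewrite mulr_ge0 ?expR_ge0 ?g0.
have gX0 j x : D x -> 0 <= g x ^+ j by move=> Dx; rewrite exprn_ge0 ?g0.
have gXb j x : D x -> 0 <= g x ^+ j <= bd ^+ j.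
  move=> Dx; rewrite gX0//= lerXn2r ?nnegrE ?g0//; have /andP[h1 h2] := gb x Dx => //.
  exact: le_trans h2.
have Mfin j : (\int[m]_(x in D) (g x ^+ j)%:E)%E \is a fin_num.
  by have [] := ge0_bounded_integral_fin mD mDy (mgX j) (gXb j).
pose M j := fine (\int[m]_(x in D) (g x ^+ j.*2)%:E)%E.
have Phifin j v : (\int[m]_(x in D) (cos_rem j.+1 (expR v * g x))%:E)%E \is a fin_num.
  have [] // := @ge0_bounded_integral_fin _ _ _ m D
    (fun x => cos_rem j.+1 (expR v * g x)) (2 * (expR v * bd) ^+ j.*2) mD mDy.
  move=> x Dx; rewrite cos_rem_ge0 ?eg0//= (le_trans (cos_rem_le _ (eg0 v x Dx)))//.
  have /andP[h1 h2] := gb x Dx.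
  rewrite ler_pM2l// lerXn2r ?nnegrE ?eg0//.
    by rewrite mulr_ge0 ?expR_ge0// (le_trans h1).
  by rewrite ler_wpM2l ?expR_ge0.
pose phi j v := fine (\int[m]_(x in D) (cos_rem j (expR v * g x))%:E)%E.
have phiE j v : (\int[m]_(x in D) (cos_rem j.+1 (expR v * g x))%:E =
    (phi j.+1 v)%:E)%E by rewrite fineK.
have phi0 j v : 0 <= phi j.+1 v.
  rewrite fine_ge0// integral_ge0// => x Dx.
  by rewrite lee_fin cos_rem_ge0 ?eg0.
have intM j v : (\int[m]_(x in D) ((expR v * g x) ^+ j.*2)%:E =
    (expR v ^+ j.*2 * M j)%:E)%E.
  rewrite EFinM /M fineK// -ge0_integralZl//; last first.
  - by move=> x Dx; rewrite lee_fin gX0.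
  - exact/measurable_EFinP.
  by apply: eq_integral => x _; rewrite -EFinM exprMn.
have phiD j v : phi j.+1 v + phi j.+2 v =
    expR v ^+ j.+1.*2 / j.+1.*2`!%:R * M j.+1.
  apply: EFin_inj; rewrite EFinD -!phiE -ge0_integralD//; last first.
  - exact/measurable_EFinP.
  - by move=> x Dx; rewrite lee_fin cos_rem_ge0 ?eg0.
  - exact/measurable_EFinP.
  - by move=> x Dx; rewrite lee_fin cos_rem_ge0 ?eg0.
  rewrite mulrAC mulrC EFinM -intM -ge0_integralZl//; last first.
  - by move=> x Dx; rewrite lee_fin exprn_ge0 ?eg0.
  - by apply/measurable_EFinP; exact: measurable_funX.
  apply: eq_integral => x _; rewrite -EFinD -EFinM (cos_remS j.+1).
  by congr EFin; ring.
pose f v := expR (- (lam * v)) * phi J.+1 v.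
pose h v := expR (- (lam * v)) * (X * exp_rem J.+1 (expR v ^+ 2 / 2)).
have f0 v : 0 <= f v by rewrite mulr_ge0 ?expR_ge0.
have h0 v : 0 <= h v by rewrite mulr_ge0 ?expR_ge0// mulr_ge0 ?exp_rem_sq_ge0.
have mNl : measurable_fun setT (fun v : R => expR (- (lam * v))).
  apply: continuous_measurable_fun.
  apply: (@continuous_compose _ (fun t => expR (- t)) ( *%R lam)).
    exact: continuous_expRN.
  exact: mulrl_continuous.
have mf : measurable_fun setT f.
  apply: measurable_funM => //; apply: (measurableT_comp (@fine_measurable _ _ _)).
    exact: measurableT.
  by apply: measurable_kernel_integral => // u u0; exact: cos_rem_ge0.
have mK2 : measurable_fun setT (fun v : R =>
    expR (- (lam * v)) * exp_rem J.+1 (expR v ^+ 2 / 2)).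
  apply: measurable_funM => //; apply: continuous_measurable_fun.
  apply: (@continuous_compose _ (fun u => exp_rem J.+1 (u ^+ 2 / 2)) expR).
    exact: continuous_exp_rem_sq.
  exact: continuous_expR.
have hE v : h v = X * (expR (- (lam * v)) * exp_rem J.+1 (expR v ^+ 2 / 2)).
  by rewrite /h; ring.
have mh : measurable_fun setT h.
  by rewrite (funext hE); exact: measurable_funM.
have inth : (\int[mu]_v (h v)%:E = (k2 * X)%:E)%E.
  under eq_integral do rewrite hE EFinM.
  rewrite ge0_integralZl//.
  - by rewrite mulrC EFinM -mk2.
  - exact/measurable_EFinP.
  - by move=> v _; rewrite lee_fin mulr_ge0 ?expR_ge0 ?exp_rem_sq_ge0.
have intf : ((\int[m]_(x in D) (g x `^ lam)%:E) * k1%:E = \int[mu]_v (f v)%:E)%E.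
  rewrite -mk1; have := @mellin_tonelli R _ _ m D (cos_rem J.+1) (cst 1) g lam mD
    lam0 (@continuous_cos_rem R J.+1) (fun u => @cos_rem_ge0 R J.+1 u isT) (cos_rem0 J)
    (measurable_cst _) mg (fun _ _ => ler01) g0.
  under eq_integral do rewrite /= mul1r.
  move=> ->; apply: eq_integral => v _; rewrite EFinM -phiE; congr (_ * _)%E.
  by apply: eq_integral => x _; rewrite /= mul1r.
have near0 v : v <= c ->
    `|f v - h v| <= X * p * expR (a * v).
  move=> vc; rewrite /f /h -mulrBr normrM ger0_norm ?expR_ge0//.
  have uU : 0 < expR v <= expR c by rewrite expR_gt0 ler_expR.
  have U1 : 1 <= expR c by rewrite -expR0 ler_expR.
  apply: (@le_trans _ _ (expR (- (lam * v)) * (X * expR v ^+ J.+1.*2 * p))).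
    rewrite ler_wpM2l ?expR_ge0// pE.
    apply: (@kernel_closeness R (fun j => phi j v) M) => //.
    - by move=> [|j].
    - by move=> [|j] // _; exact: phiD.
  rewrite (_ : a * v = - (lam * v) + J.+1.*2%:R * v); last by rewrite aE; ring.
  rewrite expRD expRM_natl le_eqVlt; apply/orP; left; apply/eqP; ring.
(* Both terms are nonnegative and O (X u^(2J)) with u = exp v, which the weight u^(- lam) makes
   decay. *)
have far v : `|f v - h v| <= X * q * expR (- (b * v)).
  rewrite /f /h -mulrBr normrM ger0_norm ?expR_ge0//.
  rewrite (_ : - (b * v) = - (lam * v) + J.*2%:R * v); last by rewrite bE; ring.
  rewrite expRD expRM_natl mulrCA ler_pM2l ?expR_gt0//.
  have t1 : X * exp_rem J.+1 (expR v ^+ 2 / 2) <= X * expR v ^+ J.*2.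
    by rewrite exp_rem_sq_le ?expR_ge0.
  have t0 : 0 <= X * exp_rem J.+1 (expR v ^+ 2 / 2).
    by rewrite mulr_ge0// exp_rem_sq_ge0.
  (* From y^(2J) <= 1 + y^(2J+2), since the hypothesis on moments starts at J + 1. *)
  have MJ : M J <= X + M J.+1.
    rewrite -lee_fin EFinD /M !fineK//.
    apply: le_trans (leeD2r _ mDX); rewrite -[m D]mul1e -integral_cst//.
    rewrite -ge0_integralD//; last first.
    - exact/measurable_EFinP.
    - by move=> x Dx; rewrite lee_fin gX0.
    apply: ge0_le_integral.
    - exact: mD.
    - by move=> x Dx; rewrite lee_fin gX0.
    - exact/measurable_EFinP.
    - apply/measurable_EFinP; apply: measurable_funD => //.
    - move=> x Dx; rewrite -EFinD lee_fin.
      have [g1|/ltW g1] := leP (g x) 1.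
        rewrite (@le_trans _ _ 1)// ?exprn_ile1 ?g0//.
        by rewrite lerDl gX0.
      rewrite (@le_trans _ _ (g x ^+ J.+1.*2))// ?lerDr//.
      by rewrite ler_weXn2l// leq_double.
  have MJ1 : M J.+1 <= X * (gauss_moment J.+1 + delta).
    have := MX J.+1; rewrite ltnSn => /(_ JN); rewrite ler_norml => /andP[_].
    by rewrite -/(M _); lra.
  have t2 : phi J.+1 v <= 2 * (expR v ^+ J.*2 * M J).
    rewrite -lee_fin -phiE EFinM -intM -ge0_integralZl//; last first.
    - by move=> x Dx; rewrite lee_fin exprn_ge0 ?eg0.
    - by apply/measurable_EFinP; exact: measurable_funX.
    apply: ge0_le_integral.
    - exact: mD.
    - by move=> x Dx; rewrite lee_fin cos_rem_ge0 ?eg0.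
    - exact/measurable_EFinP.
    - apply/measurable_EFinP; apply: measurable_funM => //.
      exact: measurable_funX.
    - by move=> x Dx; rewrite -EFinM lee_fin cos_rem_le ?eg0.
  have u0 : 0 <= expR v ^+ J.*2 by rewrite exprn_ge0 ?expR_ge0.
  have t3 : expR v ^+ J.*2 * M J <=
      expR v ^+ J.*2 * (X * (1 + gauss_moment J.+1 + delta)).
    by rewrite ler_wpM2l//; lra.
  have t4 : 0 <= phi J.+1 v by [].
  have t5 : 0 <= expR v ^+ J.*2 * (X * (1 + gauss_moment J.+1 + delta)).
    by rewrite mulr_ge0// mulr_ge0// !addr_ge0 ?gauss_moment_ge0.
  rewrite ler_norml qE; apply/andP; split; nra.
have P0 : 0 <= X * p.
  rewrite mulr_ge0// pE; apply: addr_ge0; first by rewrite !mulr_ge0 ?expR_ge0.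
  by rewrite divr_ge0// exprn_ge0// divr_ge0// sqr_ge0.
have Q0 : 0 <= X * q.
  by rewrite mulr_ge0// qE addr_ge0 ?mulr_ge0 ?addr_ge0 ?gauss_moment_ge0.
set err := (leRHS).
have le1 : (\int[mu]_v (f v)%:E <= \int[mu]_v (h v)%:E + err%:E)%E.
  apply: ge0_integral_close => // v vc.
    by have := near0 v vc; rewrite ler_norml => /andP[_]; lra.
  by have := far v; rewrite ler_norml => /andP[_]; lra.
have le2 : (\int[mu]_v (h v)%:E <= \int[mu]_v (f v)%:E + err%:E)%E.
  apply: ge0_integral_close => // v vc.
    by have := near0 v vc; rewrite ler_norml => /andP[+ _]; lra.
  by have := far v; rewrite ler_norml => /andP[+ _]; lra.
move: le1 le2; rewrite -intf inth.
have I0 : (0 <= \int[m]_(x in D) (g x `^ lam)%:E)%E.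
  by apply: integral_ge0 => x _; rewrite lee_fin powR_ge0.
(* An infinite moment would contradict the first inequality, because k1 > 0. *)
case: (\int[m]_(x in D) (g x `^ lam)%:E)%E I0 => [r| |]//= _.
  rewrite -EFinM -!EFinD !lee_fin ler_norml => h1 h2; apply/andP; split; lra.
by rewrite gt0_mulye ?lte_fin.
Qed.

End abs_moment_comparison.

(** * Choice of the truncation parameters *)

Section asymptotics.
Context {R : realType}.
Implicit Types (X A B C e a b G c t T U : R) (J N n : nat).

Lemma expR1_le4 : expR 1 <= 4 :> R.
Proof.
have h : expR (2^-1 : R) <= 2.
  rewrite -[expR _]invrK -expRN -[leRHS]invrK lef_pV2 ?posrE ?expR_gt0//.
  by apply: le_trans (expR_ge1Dx _); lra.
have -> : 1 = 2^-1 + 2^-1 :> R by field.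
rewrite expRD; have := expR_ge0 (2^-1 : R); nra.
Qed.

Lemma ge_id_expR t : t <= expR t.
Proof. by apply: le_trans (expR_ge1Dx t); rewrite lerDr. Qed.

(** The parameter t is ln ln ln X. *)
Lemma iter_ln_large T : exists X1 : R, forall X, X1 <= X ->
  exists2 t, T <= t & ln X = expR (expR t) /\ iter 4 (@ln R) X = ln t.
Proof.
exists (expR (expR (expR T))) => X X1X.
have X0 : 0 < X by apply: lt_le_trans X1X; exact: expR_gt0.
have l1 : expR (expR T) <= ln X by rewrite -ler_expR lnK.
have p1 : 0 < ln X by apply: lt_le_trans l1; exact: expR_gt0.
have l2 : expR T <= ln (ln X) by rewrite -ler_expR lnK.
have p2 : 0 < ln (ln X) by apply: lt_le_trans l2; exact: expR_gt0.
exists (ln (ln (ln X))); first by rewrite -ler_expR lnK.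
by rewrite !lnK.
Qed.

(** n is the integer part of the cube root of t; n^3 has to outgrow the exponents of order n^2 in
    [double_exp_growth]. *)
Lemma cube_root_floor t n0 : n0%:R ^+ 3 <= t ->
  exists2 n, (n0 <= n)%N & n%:R ^+ 3 <= t < n.+1%:R ^+ 3.
Proof.
move=> n0t; have t0 : 0 <= t by apply: le_trans n0t; rewrite exprn_ge0.
have ex : exists n, t < n.+1%:R ^+ 3.
  exists (Num.truncn t).
  have h1 : 1 <= (Num.truncn t).+1%:R :> R by rewrite ler1n.
  have h2 : t < (Num.truncn t).+1%:R by rewrite truncnS_gt.
  by apply: lt_le_trans h2 _; rewrite -[leLHS]expr1 ler_weXn2l.
case: (ex_minnP ex) => n tn min; exists n.
  rewrite -ltnS -(ltr_nat R) -(@ltr_pXn2r _ 3) ?nnegrE//.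
  exact: le_lt_trans tn.
rewrite tn andbT; case: n tn min => [|n] _ min; first by rewrite expr0n.
by rewrite leNgt; apply/negP => /min; rewrite ltnn.
Qed.

(** With x = ln A, y = ln B, z = ln e and N = 4 n^2, the left side is the logarithm of A^(B^(2N))
    e^N exp (9 n). *)
Lemma double_exp_growth (x y z : R) : 0 <= x -> 0 <= y -> 0 <= z ->
  exists n0 : nat, forall n, (n0 <= n)%N ->
    x * expR (8 * n%:R ^+ 2 * y) + 4 * n%:R ^+ 2 * z + 9 * n%:R
      <= expR (n%:R ^+ 3).
Proof.
move=> x0 y0 z0.
exists (Num.truncn (x + 4 * z + 9 + 8 * y)).+1 => n n0n.
have big : x + 4 * z + 9 + 8 * y <= n%:R.
  by apply/ltW/(lt_le_trans (truncnS_gt _)); rewrite ler_nat.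
have n1 : 1 <= n%:R :> R by rewrite ler1n (leq_trans _ n0n).
set m := n%:R in big n1 *.
have E1 : 1 <= expR (8 * m ^+ 2 * y).
  by rewrite -expR0 ler_expR !mulr_ge0// sqr_ge0.
have m2 : 1 <= m ^+ 2 by rewrite exprn_ege1.
apply: (@le_trans _ _ (m * m ^+ 2 * expR (8 * m ^+ 2 * y))).
  apply: (@le_trans _ _ ((x + 4 * z + 9) * (m ^+ 2 * expR (8 * m ^+ 2 * y)))).
    set F := expR _ in E1 *.
    have F2 : 1 <= m ^+ 2 * F by nra.
    have h1 : x * F <= x * (m ^+ 2 * F) by rewrite ler_wpM2l//; nra.
    have h2 : z * m ^+ 2 <= z * (m ^+ 2 * F) by rewrite ler_wpM2l//; nra.
    have h3 : m <= m ^+ 2 * F.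
      apply: (@le_trans _ _ (m ^+ 2)); first by rewrite expr2; nra.
      by nra.
    by move: h1 h2 h3; lra.
  rewrite -[leRHS]mulrA ler_wpM2r//; last by lra.
  by rewrite mulr_ge0// ?expR_ge0// sqr_ge0.
(* The resulting exponent m + m^2 + 8 m^2 y is at most m^2 (2 + 8 y) <= m^3. *)
apply: (@le_trans _ _ (expR m * expR (m ^+ 2) * expR (8 * m ^+ 2 * y))).
  rewrite ler_wpM2r ?expR_ge0//; apply: ler_pM; rewrite ?ge_id_expR//; lra.
rewrite -!expRD ler_expR.
have : m <= m ^+ 2 by rewrite expr2; nra.
have : m ^+ 2 * (2 + 8 * y) <= m ^+ 2 * m by rewrite ler_wpM2l//; lra.
by rewrite -exprSr; lra.
Qed.

(** With N = 4 n^2, (2 n^2)^N / N! <= exp (2 n^2); dividing by 4^N >= exp (4 n^2) gives the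
    bound. *)
Lemma factorial_tail n :
  (n%:R ^+ 2 / 2) ^+ (4 * n ^ 2) / (4 * n ^ 2)`!%:R <= expR (- (2 * n%:R ^+ 2)) :> R.
Proof.
set N := (4 * n ^ 2)%N.
have x0 : 0 <= 2 * n%:R ^+ 2 :> R by rewrite mulr_ge0// sqr_ge0.
have := exprn_le_fact_expR N x0.
have -> : 2 * n%:R ^+ 2 = 4 * (n%:R ^+ 2 / 2) :> R by field.
rewrite exprMn -mulrA => h.
have e4 : expR (4 * n%:R ^+ 2) <= 4 ^+ N :> R.
  have -> : 4 * n%:R ^+ 2 = N%:R * 1 :> R by rewrite /N natrM natrX mulr1.
  by rewrite expRM_natl lerXn2r ?nnegrE ?expR_ge0// expR1_le4.
have y0 : 0 <= (n%:R ^+ 2 / 2) ^+ N / N`!%:R :> R.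
  by rewrite divr_ge0// exprn_ge0// divr_ge0// sqr_ge0.
have h2 := le_trans (ler_wpM2r y0 e4) h.
rewrite -(ler_pM2l (expR_gt0 (4 * n%:R ^+ 2))) -expRD.
apply: le_trans h2 _; rewrite ler_expR; lra.
Qed.

(** Take t = ln ln ln X, n the integer part of its cube root, N = 4 n^2 and exp c = n. The near
    error is O (n^(-2)), the far one O (n^(-b)) with b <= 2, and ln t = O (n^b). *)
Lemma error_choice C A B e a b G J : 0 <= C -> 1 < A -> 1 < B -> 1 <= e ->
  0 < a <= 2 -> 0 < b <= 2 -> 0 <= G ->
  exists C' X1 : R, forall X, X1 <= X -> exists N c,
    [/\ (J < N)%N, 0 <= c &
     let delta := C * A `^ (B ^+ N.*2) * e ^+ N / ln X in
     (delta * N.+1%:R * expR (expR c) + (expR c ^+ 2 / 2) ^+ N / N`!%:R) *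
       (expR (a * c) / a) +
     (2 * (1 + G + delta) + 1) * (expR (- (b * c)) / b)
       <= C' / iter 4 (@ln R) X].
Proof.
move=> C0 A1 B1 e1 /andP[a0 a2] /andP[b0 b2] G0.
have [n1 growth] := double_exp_growth (ltW (ln_gt0 A1)) (ltW (ln_gt0 B1)) (ln_ge0 e1).
pose n0 := maxn 2 (maxn n1 J.+1).
have [X1 large] := iter_ln_large (n0%:R ^+ 3).
(* In the near error, 5 C comes from [delta] and 1 from the factorial tail; the far error uses delta
   <= C. *)
pose K := (5 * C + 1) / a + (2 * (1 + G + C) + 1) / b.
exists (K * (3 / b * expR (b * ln 2))), X1 => X /large[t n0t [lnX ->]].
have [n n0n /andP[nt tn]] := cube_root_floor n0t.
have n2 : (2 <= n)%N by rewrite (leq_trans _ n0n)// leq_maxl.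
have nn1 : (n1 <= n)%N by rewrite (leq_trans _ n0n)// /n0 !leq_max leqnn orbT.
have nJ : (J < n)%N by rewrite (leq_trans _ n0n)// /n0 !leq_max leqnn !orbT.
have m0 : 0 < n%:R :> R by rewrite ltr0n (leq_trans _ n2).
have m1 : 1 <= n%:R :> R by rewrite ler1n (leq_trans _ n2).
exists (4 * n ^ 2)%N, (ln n%:R); split.
- by rewrite (leq_trans nJ)// expnS expn1 mulnA leq_pmull// muln_gt0/= (leq_trans _ n2).
- exact: ln_ge0.
move=> delta; rewrite lnK ?posrE//.
set N := (4 * n ^ 2)%N in delta *.
(* In logarithms this is [growth], since ln ln X = exp t >= exp (n^3). *)
have deltaC : delta <= C * expR (- (9 * n%:R)).
  rewrite /delta -!mulrA ler_wpM2l// lnX !mulrA -expRN.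
  have NE : N%:R = 4 * n%:R ^+ 2 :> R by rewrite natrM natrX.
  have -> : A `^ (B ^+ N.*2) = expR (ln A * expR (8 * n%:R ^+ 2 * ln B)).
    rewrite /powR gt_eqF ?(lt_trans ltr01)// mulrC; congr (expR (_ * _)).
    rewrite (_ : 8 * _ = N.*2%:R); last by rewrite -mul2n natrM NE; ring.
    by rewrite expRM_natl lnK// posrE (lt_trans ltr01).
  have -> : e ^+ N = expR (4 * n%:R ^+ 2 * ln e).
    by rewrite -NE expRM_natl lnK// posrE (lt_le_trans ltr01).
  rewrite -!expRD ler_expR.
  have := growth n nn1.
  have : expR (n%:R ^+ 3) <= expR t by rewrite ler_expR.
  by lra.
have delta0 : 0 <= delta.
  by rewrite /delta lnX divr_ge0 ?expR_ge0// !mulr_ge0 ?powR_ge0// exprn_ge0// (le_trans ler01).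
have nE : n%:R <= expR n%:R :> R by exact: ge_id_expR.
set E := expR (n%:R : R) in nE *.
have E0 : 0 < E by exact: expR_gt0.
have dE : delta * E ^+ 9 <= C.
  rewrite /E -expRM_natl -ler_pdivlMr ?expR_gt0// -expRN.
  exact: deltaC.
have E1 : 1 <= E by exact: le_trans nE.
have dC : delta <= C.
  by apply: le_trans dE; rewrite ler_peMr// exprn_ege1.
have nb : n%:R ^- 2 <= expR (- (b * ln n%:R)) :> R.
  rewrite expRN lef_pV2 ?posrE ?expR_gt0 ?exprn_gt0//.
  rewrite -[n%:R in leRHS]lnK ?posrE// -expRM_natl ler_expR ler_wpM2r//.
  exact: ln_ge0.
have na : expR (a * ln n%:R) <= n%:R ^+ 2 :> R.
  rewrite -[n%:R in leRHS]lnK ?posrE// -expRM_natl ler_expR ler_wpM2r//.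
  exact: ln_ge0.
set Eb := expR (- (b * _)) in nb *.
set Ea := expR (a * _) in na *.
(* The decay exp (- 9 n) leaves room for exp U = exp n and all powers of n, each n being at most E =
   exp n. *)
have part1 : delta * N.+1%:R * E * n%:R ^+ 2 <= 5 * C * n%:R ^- 2.
  rewrite ler_pdivlMr ?exprn_gt0//.
  have NS : N.+1%:R <= 5 * n%:R ^+ 2 :> R.
    rewrite -natr1 natrM natrX; have : 1 <= n%:R ^+ 2 :> R by rewrite exprn_ege1.
    by lra.
  have n6 : n%:R ^+ 6 <= E ^+ 6 by rewrite lerXn2r ?nnegrE// ltW.
  apply: (@le_trans _ _ (5 * (delta * E ^+ 9))); last by rewrite ler_pM2l.
  apply: (@le_trans _ _ (delta * (5 * n%:R ^+ 2) * E * n%:R ^+ 2 * n%:R ^+ 2)).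
    by rewrite !ler_wpM2r ?sqr_ge0 ?(ltW E0)// ler_wpM2l.
  rewrite (_ : _ * n%:R ^+ 2 = 5 * (delta * (E * n%:R ^+ 6))); last by ring.
  rewrite ler_pM2l// ler_wpM2l//.
  apply: (@le_trans _ _ (E * E ^+ 6)); first by rewrite ler_pM2l.
  by rewrite -exprS ler_weXn2l.
have part2 : (n%:R ^+ 2 / 2) ^+ N / N`!%:R * n%:R ^+ 2 <= n%:R ^- 2 :> R.
  rewrite -ler_pdivlMr ?exprn_gt0// -expr2 -exprVn -exprM.
  apply: le_trans (factorial_tail n) _.
  rewrite expRN exprVn lef_pV2 ?posrE ?expR_gt0 ?exprn_gt0//.
  rewrite -[2 * (n%:R ^+ 2)]/(2%:R * _) expRM_natl exprM lerXn2r ?nnegrE ?exprn_ge0 ?expR_ge0//.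
  exact: ge_id_expR.
have K0 : 0 <= K.
  by rewrite /K addr_ge0// divr_ge0 ?(ltW a0) ?(ltW b0)//; lra.
have total : (delta * N.+1%:R * E + (n%:R ^+ 2 / 2) ^+ N / N`!%:R) * (Ea / a) +
    (2 * (1 + G + delta) + 1) * (Eb / b) <= K * Eb.
  rewrite /K [leRHS]mulrDl; apply: lerD.
    rewrite [leLHS]mulrA [leRHS]mulrAC ler_pM2r ?invr_gt0//.
    apply: (@le_trans _ _ ((delta * N.+1%:R * E + (n%:R ^+ 2 / 2) ^+ N / N`!%:R) * n%:R ^+ 2)).
      rewrite ler_wpM2l//; apply: addr_ge0.
        exact: (mulr_ge0 (mulr_ge0 delta0 (ler0n _ _)) (ltW E0)).
      by rewrite divr_ge0// exprn_ge0// divr_ge0// sqr_ge0.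
    rewrite mulrDl; apply: (@le_trans _ _ ((5 * C + 1) * n%:R ^- 2)).
      by rewrite [leRHS]mulrDl mul1r lerD.
    by rewrite ler_wpM2l//; lra.
  rewrite [leLHS]mulrA [leRHS]mulrAC ler_pM2r ?invr_gt0//.
  by rewrite ler_wpM2r ?expR_ge0//; lra.
apply: le_trans total _; rewrite -mulrA ler_wpM2l//.
have t1 : 1 < t.
  by apply: lt_le_trans nt; rewrite exprn_egt1// ltr1n.
(* Because t < (n + 1)^3 <= (2 n)^3. *)
have lt3 : ln t <= 3 * (ln 2 + ln n%:R).
  have -> : 3 * (ln 2 + ln n%:R) = ln ((2 * n%:R) ^+ 3) :> R.
    by rewrite lnXn ?mulr_gt0// lnM ?posrE// mulr_natl.
  have t0 : 0 < t by exact: lt_trans t1.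
  rewrite ler_ln ?posrE ?exprn_gt0 ?mulr_gt0//.
  apply: le_trans (ltW tn) _; rewrite lerXn2r ?nnegrE ?mulr_ge0//.
  by rewrite -natr1; lra.
rewrite ler_pdivlMr ?ln_gt0// /Eb expRN ler_pdivrMl ?expR_gt0//.
rewrite -(ler_pM2r b0).
rewrite (_ : _ * _ * b = 3 * (expR (b * ln 2) * expR (b * ln n%:R))); last first.
  by field; rewrite gt_eqF.
(* The inequality y <= exp y at y = b ln (2 n) bounds b ln t by 3 (2 n)^b. *)
rewrite -expRD -mulrDr; have := ge_id_expR (b * (ln 2 + ln n%:R)).
have : ln t * b <= 3 * (ln 2 + ln n%:R) * b by rewrite ler_pM2r.
by lra.
Qed.

End asymptotics.

(** * Deviations of the Chebyshev function *)

Section deviation.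
Context {R : realType}.
Implicit Types (x y X h s r : R) (j n : nat).
Local Notation mu := (@lebesgue_measure R).

Lemma Gamma_nat n : Gamma (n%:R + 1) = n`!%:R :> R.
Proof.
rewrite /Gamma /Rintegral.
have -> : (\int[mu]_(t in `]0%R, +oo[) (t `^ (n%:R + 1 - 1) * expR (- t))%:E =
    n`!%:R%:E * \int[mu]_(t in `[0%R, +oo[) (t ^+ n / n`!%:R * expR (- t))%:E)%E.
  have cE : continuous (fun t : R => t ^+ n / n`!%:R * expR (- t)).
    apply: continuous_mul; last exact: continuous_expRN.
    by move=> t; apply: cvgMr_tmp; exact: exprn_continuous.
  rewrite -integral_itv_obnd_cbnd; last exact: continuous_measurable_itv.
  rewrite -ge0_integralZl//; last first.
  - move=> t /=; rewrite in_itv/= andbT => t0.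
    by rewrite lee_fin mulr_ge0 ?expR_ge0// divr_ge0// exprn_ge0// ltW.
  - exact: continuous_measurable_itv.
  apply: eq_integral => t; rewrite inE/= in_itv/= andbT => t0.
  rewrite addrK powR_mulrn ?ltW// -EFinM mulrA mulrC; congr EFin.
  by field; exact: fact_neq0.
by rewrite integral_fact_expRN mule1.
Qed.

Lemma mangoldt_ge0 n : 0 <= mangoldt R n.
Proof.
rewrite /mangoldt; case E : (primes n) => [//|p [|//]].
apply: ln_ge0; rewrite ler1n prime_gt0//.
have : p \in primes n by rewrite E mem_head.
by rewrite mem_primes => /and3P[].
Qed.

Lemma chebyshev_psi_ge0 x : 0 <= chebyshev_psi x.
Proof. by apply: sumr_ge0 => i _; exact: mangoldt_ge0. Qed.

Lemma chebyshev_psi_nondecreasing : {homo @chebyshev_psi R : x y / x <= y}.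
Proof.
move=> x y xy; rewrite /chebyshev_psi.
have le : ((Num.truncn x).+1 <= (Num.truncn y).+1)%N by rewrite ltnS le_truncn.
by rewrite (big_cat_nat _ le)//= lerDl sumr_ge0// => i _; exact: mangoldt_ge0.
Qed.

Lemma measurable_deviation h (D : set R) : measurable D ->
  measurable_fun D (fun x => chebyshev_psi (x + h) - chebyshev_psi x - h).
Proof.
move=> mD; apply: measurable_funB => //; apply: measurable_funB.
  apply: nondecreasing_measurable => // x y xy.
  by apply: chebyshev_psi_nondecreasing; rewrite lerD2r.
by apply: nondecreasing_measurable => //; exact: chebyshev_psi_nondecreasing.
Qed.

(** A crude bound, uniform in x, that makes the moments finite. *)
Lemma deviation_le X h x : 0 <= h -> x <= X ->
  `|chebyshev_psi (x + h) - chebyshev_psi x - h|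
    <= chebyshev_psi (X + h) + chebyshev_psi X + h.
Proof.
move=> h0 xX.
have := chebyshev_psi_nondecreasing xX.
have xXh : x + h <= X + h by rewrite lerD2r.
have := chebyshev_psi_nondecreasing xXh.
have := chebyshev_psi_ge0 x; have := chebyshev_psi_ge0 (x + h).
by rewrite ler_norml => *; apply/andP; split; lra.
Qed.

Lemma Rintegral_normalize (f : R -> R) (D : set R) s r : measurable D ->
  measurable_fun D f -> 0 < s ->
  \int[mu]_(x in D) (`|f x| `^ r) =
  s `^ (r / 2) * fine (\int[mu]_(x in D) ((`|f x| / s `^ 2^-1) `^ r)%:E)%E.
Proof.
move=> mD mf s0; have p0 : 0 < s `^ 2^-1 by rewrite powR_gt0.
have q0 : 0 < s `^ (r / 2) by rewrite powR_gt0.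
have mg : measurable_fun D (fun x => (`|f x| / s `^ 2^-1) `^ r).
  apply: (measurableT_comp (measurable_powR _)).
  by apply: measurable_funM => //; apply: measurableT_comp.
rewrite /Rintegral.
have -> : (\int[mu]_(x in D) (`|f x| `^ r)%:E = (s `^ (r / 2))%:E *
    \int[mu]_(x in D) ((`|f x| / s `^ 2^-1) `^ r)%:E)%E.
  rewrite -ge0_integralZl//; last first.
  - by rewrite lee_fin ltW.
  - by move=> x _; rewrite lee_fin powR_ge0.
  - exact/measurable_EFinP.
  apply: eq_integral => x _; rewrite -EFinM; congr EFin.
  rewrite [r / 2]mulrC powRrM -powRM ?divr_ge0 ?(ltW p0)//.
  by rewrite mulrC divfK// gt_eqF.
(* If the integral is infinite, [fine] returns 0 on both sides. *)
case: (\int[mu]_(x in D) _)%E => [z| |] //=.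
  by rewrite gt0_muley ?lte_fin//= mulr0.
by rewrite gt0_muleNy ?lte_fin//= mulr0.
Qed.

End deviation.

(** * Normalized moments and the asymptotic formula *)

(** The upper bound on h gives ln (X / h) >= eps ln X. The constant 1 + 1/eps is at least 1, so its
    powers increase with the exponent. *)
Lemma range_bounds (R : realType) (eps X h : R) : 0 < eps -> 1 < X ->
  X `^ eps <= h <= X `^ (1 - eps) ->
  [/\ 0 < h, 0 < ln (X / h) & ln X <= (1 + eps^-1) * ln (X / h)].
Proof.
move=> e0 X1 /andP[hl hu]; have X0 : 0 < X by exact: lt_trans X1.
have h0 : 0 < h by apply: lt_le_trans hl; exact: powR_gt0.
have lX : 0 < ln X by exact: ln_gt0.
have l : eps * ln X <= ln (X / h).
  rewrite ln_div ?posrE//.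
  have : ln h <= ln (X `^ (1 - eps)) by rewrite ler_ln ?posrE ?powR_gt0.
  by rewrite ln_powR; lra.
have l0 : 0 < ln (X / h) by apply: lt_le_trans l; exact: mulr_gt0.
split => //.
have : eps^-1 * (eps * ln X) <= eps^-1 * ln (X / h).
  by rewrite ler_wpM2l// invr_ge0 ltW.
by rewrite mulKf ?gt_eqF//; lra.
Qed.

Lemma gauss_coefficient (R : realType) j :
  Gamma (j.*2%:R + 1) / (Gamma (j.*2%:R / 2 + 1) * 2 `^ (j.*2%:R / 2)) =
  gauss_moment j :> R.
Proof.
have -> : j.*2%:R / 2 = j%:R :> R by rewrite -mul2n natrM; field.
by rewrite !Gamma_nat powR_mulrn.
Qed.

(** The hypothesis for k = 2j divided by s^j, where s = h ln (X / h); the error (ln X)^(j-1) costs a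
    factor (1 + 1/eps)^j and saves 1 / ln X. *)
Lemma normalized_even_moment (R : realType) (eps A B C X h : R) (j : nat) :
  0 < eps -> 1 < X -> X `^ eps <= h <= X `^ (1 - eps) ->
  `| \int[lebesgue_measure]_(x in `[1, X])
       ((chebyshev_psi (x + h) - chebyshev_psi x - h) ^+ j.*2)
     - Gamma (j.*2%:R + 1) / (Gamma (j.*2%:R / 2 + 1) * 2 `^ (j.*2%:R / 2))
       * X * h `^ (j.*2%:R / 2) * ln (X / h) `^ (j.*2%:R / 2) |
  <= C * (A `^ (B ^+ j.*2) * X * h `^ (j.*2%:R / 2)
          * ln X `^ (j.*2%:R / 2 - 1)) ->
  `| fine (\int[lebesgue_measure]_(x in `[1%R, X])
       ((`|chebyshev_psi (x + h) - chebyshev_psi x - h|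
          / (h * ln (X / h)) `^ 2^-1) ^+ j.*2)%:E)%E - X * gauss_moment j |
  <= X * (`|C| * A `^ (B ^+ j.*2) * (1 + eps^-1) ^+ j / ln X).
Proof.
move=> e0 X1 range; have [h0 l0 lXl] := range_bounds e0 X1 range.
have lX0 : 0 < ln X by exact: ln_gt0.
have X0 : 0 < X by exact: lt_trans X1.
rewrite gauss_coefficient; set s := h * ln (X / h).
have s0 : 0 < s by rewrite mulr_gt0.
have jE : j.*2%:R / 2 = j%:R :> R by rewrite -mul2n natrM; field.
set f := fun x => chebyshev_psi (x + h) - chebyshev_psi x - h.
have intE : \int[lebesgue_measure]_(x in `[1, X]) (f x ^+ j.*2) = s ^+ j *
    fine (\int[lebesgue_measure]_(x in `[1%R, X])
       ((`|f x| / s `^ 2^-1) ^+ j.*2)%:E)%E.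
  have := @Rintegral_normalize R f `[1, X]%classic s j.*2%:R
    (measurable_itv _) (measurable_deviation h (measurable_itv _)) s0.
  rewrite jE powR_mulrn ?(ltW s0)// => E.
  transitivity (\int[lebesgue_measure]_(x in `[1, X]) (`|f x| `^ j.*2%:R)).
    apply: eq_Rintegral => x _; rewrite powR_mulrn// -normrX ger0_norm//.
    by rewrite -mul2n exprM exprn_ge0// sqr_ge0.
  rewrite E; congr (_ * fine _); apply: eq_integral => x _.
  by rewrite powR_mulrn// divr_ge0// powR_ge0.
rewrite intE; set M := fine _; rewrite jE.
rewrite !powR_mulrn ?(ltW h0) ?(ltW l0)//.
have -> : ln X `^ (j%:R - 1) = ln X ^+ j / ln X.
  rewrite powRB; last by rewrite (gt_eqF lX0) implybT.
  by rewrite powR_mulrn ?powRr1 ?(ltW lX0).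
have -> : s ^+ j * M - gauss_moment j * X * h ^+ j * ln (X / h) ^+ j =
    s ^+ j * (M - X * gauss_moment j) by rewrite /s exprMn; ring.
rewrite normrM ger0_norm ?exprn_ge0 ?(ltW s0)// => le.
rewrite -(ler_pM2l (exprn_gt0 j s0)); apply: le_trans le _.
have AB : 0 <= A `^ (B ^+ j.*2) by exact: powR_ge0.
set Q := A `^ _ in AB *.
(* The sign of C is unknown, hence the absolute value. *)
apply: (@le_trans _ _ (`|C| * (Q * X * h ^+ j * (ln X ^+ j / ln X)))).
  rewrite ler_wpM2r ?ler_norm// !mulr_ge0 ?invr_ge0 ?exprn_ge0 ?(ltW X0) ?(ltW h0) ?(ltW lX0)//.
have lXj : ln X ^+ j <= (1 + eps^-1) ^+ j * ln (X / h) ^+ j.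
  rewrite -exprMn lerXn2r ?nnegrE ?(ltW lX0)//.
  by rewrite mulr_ge0 ?(ltW l0)// addr_ge0// invr_ge0 ltW.
have W : 0 <= `|C| * (Q * X * h ^+ j) / ln X.
  by rewrite !mulr_ge0 ?invr_ge0 ?exprn_ge0 ?(ltW X0) ?(ltW h0) ?(ltW lX0).
have := ler_wpM2l W lXj; rewrite /s exprMn => W2.
apply: le_trans (le_trans _ W2) _; rewrite le_eqVlt; apply/orP; left; apply/eqP; ring.
Qed.

Theorem theorem1 (R : realType) (eps A B : R)
  (eps_gt0 : 0 < eps) (A_gt1 : 1 < A) (B_gt1 : 1 < B)
  (even_moments : exists C X0 : R, forall k : nat, (0 < k)%N -> ~~ odd k ->
    forall X h : R, X0 <= X -> X `^ eps <= h <= X `^ (1 - eps) ->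
    `| \int[lebesgue_measure]_(x in `[1, X])
         ((chebyshev_psi (x + h) - chebyshev_psi x - h) ^+ k)
       - Gamma (k%:R + 1) / (Gamma (k%:R / 2 + 1) * 2 `^ (k%:R / 2))
         * X * h `^ (k%:R / 2) * ln (X / h) `^ (k%:R / 2) |
    <= C * (A `^ (B ^+ k) * X * h `^ (k%:R / 2) * ln X `^ (k%:R / 2 - 1))) :
  forall lambda : R, 0 < lambda ->
  exists C X0 : R, forall X h : R,
    X0 <= X -> X `^ eps <= h <= X `^ (1 - eps) ->
    `| \int[lebesgue_measure]_(x in `[1, X])
         (`| chebyshev_psi (x + h) - chebyshev_psi x - h | `^ lambda)
       - Gamma (lambda + 1) / (Gamma (lambda / 2 + 1) * 2 `^ (lambda / 2))
         * X * h `^ (lambda / 2) * ln (X / h) `^ (lambda / 2) |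
    <= C * (X * h `^ (lambda / 2) * ln (X / h) `^ (lambda / 2)
            / iter 4 (@ln R) X).
Proof.
move=> lam lam0; have [C [X0 HM]] := even_moments.
pose e := 1 + eps^-1.
have e1 : 1 <= e by rewrite lerDl invr_ge0 ltW.
pose g X h x := `|chebyshev_psi (x + h) - chebyshev_psi x - h|
  / (h * ln (X / h)) `^ 2^-1 : R.
pose I X h (F : R -> R) :=
  fine (\int[lebesgue_measure]_(x in `[1%R, X]) (F (g X h x))%:E)%E.
pose delta X j := `|C| * A `^ (B ^+ j.*2) * e ^+ j / ln X.
have moments X h j : X0 <= X -> 1 < X -> X `^ eps <= h <= X `^ (1 - eps) ->
    (0 < j)%N -> `|I X h (fun y => y ^+ j.*2) - X * gauss_moment j| <= X * delta X j.
  move=> X0X X1 range j0; apply: normalized_even_moment => //.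
  by apply: HM => //; rewrite ?double_gt0 ?odd_double.
set G := Gamma (lam + 1) / _.
(* Multiplying by s^(lam/2) with s = h ln (X / h) recovers the unnormalized statement. *)
suff [C' [X1 H]] : exists C' X1 : R, forall X h : R, X1 <= X ->
    X0 <= X -> 1 < X -> X `^ eps <= h <= X `^ (1 - eps) ->
    `|I X h (fun y => y `^ lam) - X * G| <= X * (C' / iter 4 (@ln R) X).
  exists C', (Num.max 2 (Num.max X0 X1)) => X h.
  rewrite !ge_max => /and3P[X2 X0X X1X] range.
  have X1' : 1 < X by apply: lt_le_trans X2; rewrite ltr1n.
  have [h0 l0 _] := range_bounds eps_gt0 X1' range.
  have {H} := H X h X1X X0X X1' range.
  set s := h * ln (X / h); have s0 : 0 < s by rewrite mulr_gt0.
  rewrite (@Rintegral_normalize R _ `[1, X]%classic s lam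
    (measurable_itv _) (measurable_deviation h (measurable_itv _)) s0).
  rewrite -/(I X h (fun y => y `^ lam)); set M := I _ _ _.
  have sE : s `^ (lam / 2) = h `^ (lam / 2) * ln (X / h) `^ (lam / 2).
    by rewrite powRM ?(ltW h0) ?(ltW l0).
  have p0 : 0 < s `^ (lam / 2) by rewrite powR_gt0.
  move=> H; have := ler_wpM2l (ltW p0) H.
  rewrite -[X in X * `|_|](ger0_norm (ltW p0)) -normrM.
  rewrite sE => H2; apply: le_trans (le_trans _ H2) _.
    rewrite le_eqVlt; apply/orP; left; apply/eqP; congr (`|_|); ring.
  rewrite le_eqVlt; apply/orP; left; apply/eqP; ring.
(* Thus 2J <= lam < 2J + 2; equality is an even moment, and the open strip is the general case. *)
pose J := Num.truncn (lam / 2).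
have lam20 : 0 <= lam / 2 by rewrite divr_ge0// ltW.
have [J1 J2] : J.*2%:R <= lam /\ lam < J.+1.*2%:R.
  have /andP[] := truncn_itv lam20; rewrite -/J -!mul2n !natrM.
  by split; lra.
move: J1; rewrite le_eqVlt => /predU1P[lamE|J1].
  have J0 : (0 < J)%N.
    by case: (J) lamE => // lamE; move: lam0; rewrite -lamE ltxx.
  have [X1 large] := @iter_ln_large R 2.
  (* With J fixed the error is O (1 / ln X), stronger than required; t >= 2 makes ln t positive. *)
  exists (`|C| * A `^ (B ^+ J.*2) * e ^+ J), X1 => X h X1X X0X X1' range.
  have [t t2 [lnX ->]] := large X X1X.
  have -> : G = gauss_moment J by rewrite /G -lamE gauss_coefficient.
  have IE : I X h (fun y => y `^ lam) = I X h (fun y => y ^+ J.*2).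
    congr fine; apply: eq_integral => x _.
    by rewrite -lamE powR_mulrn// divr_ge0// powR_ge0.
  rewrite IE; apply: le_trans (moments X h J X0X X1' range J0) _.
  have X0' : 0 < X by exact: lt_trans X1'.
  rewrite ler_pM2l// /delta ler_wpM2l//.
    by rewrite !mulr_ge0 ?powR_ge0// exprn_ge0// (le_trans ler01).
  have t0 : 0 < t by apply: lt_le_trans t2; rewrite ltr0n.
  have lt0 : 0 < ln t by apply: ln_gt0; apply: lt_le_trans t2; rewrite ltr1n.
  have lX0 : 0 < ln X by exact: ln_gt0.
  rewrite lef_pV2 ?posrE// lnX.
  apply: (le_trans (ltW (ln_sublinear t0))).
  by apply: (le_trans (ge_id_expR t)); exact: ge_id_expR.
have lamJ : J.*2%:R < lam < J.+1.*2%:R by rewrite J1 J2.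
have [k1 [k2 [k10 mk1 mk2 GE]]] := Gamma_ratio lamJ.
have JS : J.+1.*2%:R = J.*2%:R + 2 :> R by rewrite doubleS -addn2 natrD.
have a02 : 0 < J.+1.*2%:R - lam <= 2 by apply/andP; split; lra.
have b02 : 0 < lam - J.*2%:R <= 2 by apply/andP; split; lra.
have [C' [X1 choice]] := @error_choice R `|C| A B e _ _ (gauss_moment J.+1) J
  (normr_ge0 _) A_gt1 B_gt1 e1 a02 b02 (gauss_moment_ge0 _).
(* The comparison bounds k1 times the moment, hence the division by k1. *)
exists (C' / k1), X1 => X h X1X X0X X1' range.
have [N [c [JN c0 err]]] := choice X X1X.
have X0' : 0 < X by exact: lt_trans X1'.
have [h0 l0 _] := range_bounds eps_gt0 X1' range.
have p0 : 0 < (h * ln (X / h)) `^ 2^-1 by rewrite powR_gt0// mulr_gt0.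
have lX0 : 0 < ln X by exact: ln_gt0.
have dX0 : 0 <= delta X N.
  rewrite /delta divr_ge0 ?(ltW lX0)// !mulr_ge0 ?powR_ge0// exprn_ge0//.
  exact: le_trans e1.
have mD : measurable (`[1, X]%classic : set R) by exact: measurable_itv.
have mg : measurable_fun (`[1, X]%classic : set R) (g X h).
  apply: measurable_funM => //; apply: measurableT_comp => //.
  exact: measurable_deviation.
have gb x : (`[1, X]%classic : set R) x -> 0 <= g X h x <=
    (chebyshev_psi (X + h) + chebyshev_psi X + h) / (h * ln (X / h)) `^ 2^-1.
  rewrite /= in_itv/= => /andP[_ xX].
  by rewrite /g divr_ge0 ?(ltW p0)//= ler_pM2r ?invr_gt0// deviation_le// ltW.
have mDX : (lebesgue_measure (`[1%R, X]%classic : set R) <= X%:E)%E.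
  by rewrite lebesgue_measure_itv/= lte_fin X1' -EFinB lee_fin; lra.
(* [delta X j] increases with j because A, B > 1 and e >= 1, so its value at N serves for every j <=
   N. *)
have mom j : (J < j <= N)%N -> `|I X h (fun y => y ^+ j.*2) - X * gauss_moment j|
    <= X * delta X N.
  move=> /andP[Jj jN]; apply: le_trans (moments X h j X0X X1' range _) _.
    exact: leq_ltn_trans Jj.
  rewrite ler_pM2l// /delta ler_pM2r ?invr_gt0//.
  apply: ler_pM.
  - by rewrite mulr_ge0 ?powR_ge0.
  - by rewrite exprn_ge0// (le_trans ler01).
  - rewrite ler_wpM2l// ler_powR ?(ltW A_gt1)//.
    by rewrite ler_weXn2l ?(ltW B_gt1)// leq_double.
  - by rewrite ler_weXn2l.
have := @abs_moment_comparison R _ _ lebesgue_measure _ _ _ _ _ _ _ _ _ _ _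
  mD mg gb mDX (ltW X0') dX0 c0 JN lamJ k10 mk1 mk2 mom
  _ _ _ _ erefl erefl erefl erefl.
rewrite -/(I X h (fun y => y `^ lam)); set M := I _ _ _ => cmp.
rewrite -(ler_pM2l k10) -[X in X * `|_|](ger0_norm (ltW k10)) -normrM.
rewrite (_ : G = k2 / k1)// (_ : k1 * (M - _) = k1 * M - k2 * X); last by field; rewrite gt_eqF.
apply: le_trans cmp _; rewrite -!mulrA -mulrDr.
rewrite (_ : k1 * (X * _) = X * (C' / iter 4 (@ln R) X)); last first.
  by rewrite !mulrA; congr (_ / _); field; rewrite gt_eqF.
rewrite ler_pM2l//; apply: le_trans err.
by rewrite !mulrA.
Qed.
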